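(* (i) Let $\alpha=0$, $r>0$, and $0<p\le1$. There are constants $C_{r,p},\widetilde{C}_{r,p}>0$ such that for all $n\in\mathbb{N}$ $$\varrho_{\lceil C_{r,p}\,n\log(n+1)^4\rceil}(\mathcal{A}^r_{0,p}([-1,1]))_{L^2(\mu_0)}\le\widetilde{C}_{r,p}\,n^{-(r+\frac1p-1)}.$$ (ii) Let $\alpha=-\frac12$, $r>0$, and $0<p\le1$. There are constants $C_{r,p},\widetilde{C}_{r,p}>0$ such that for all $n\in\mathbb{N}$ $$\varrho_{\lceil C_{r,p}\,n\log(n+1)^4\rceil}(\mathcal{A}^r_{-\frac12,p}([-1,1]))_{L^2(\mu_{-1/2})}\le\widetilde{C}_{r,p}\,n^{-(r+\frac1p-\frac12)}.$$ In particular, in the Banach space case $p=1$ there are constants $C_{r,1},\widetilde{C}_r>0$ such that for all $n\in\mathbb{N}$ $$\varrho_{\lceil C_{r,1}\,n\log(n+1)^4\rceil}(\mathcal{A}^r_{-\frac12,1}([-1,1]))_{L^2(\mu_{-1/2})}\le\widetilde{C}_r\,n^{-(r+\frac12)}.$$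
   Context: For $\alpha\in\{-\frac12,0\}$ let $\mu_\alpha$ be the probability measure on $[-1,1]$ with $\mathrm{d}\mu_\alpha(x)=c_\alpha(1-x^2)^\alpha\,\mathrm{d}x$, $c_\alpha=(\int_{-1}^1(1-x^2)^\alpha\,\mathrm{d}x)^{-1}$, and let $(p^\alpha_n)_{n\in\mathbb{N}_0}$ be the unique sequence of polynomials orthonormal in $L^2(\mu_\alpha)$ with $\deg p^\alpha_n=n$ and positive leading coefficient (orthonormal Chebyshev polynomials of the first kind for $\alpha=-\frac12$, orthonormal Legendre polynomials for $\alpha=0$). For $r\ge0$, $0<p\le1$, the Wiener-type space is $$\mathcal{A}^r_{\alpha,p}([-1,1])=\Big\{f=\sum_{n=0}^\infty\beta_np^\alpha_n:\ \|f\|_{\mathcal{A}^r_{\alpha,p}}:=\Big(\sum_{n\in\mathbb{N}_0}|\beta_n(1+n)^r|^p\Big)^{1/p}<\infty\Big\},$$ where $\beta_n=\langle f,p_n^\alpha\rangle_{L^2(\mu_\alpha)}$. Point values of $f$ are given by the pointwise (absolutely) convergent series: on $[-1,1]$ for $\alpha=-\frac12$; on $(-1,1)$ for $\alpha=0$, where $x\mapsto(1-x^2)^{1/4}f(x)$ is bounded and continuous. Sampling numbers: $\varrho_m(\mathcal{F})_X=\inf_{t_1,\ldots,t_m\in\Omega}\inf_{R:\mathbb{C}^m\to X}\sup_{\|f\|_{\mathcal{F}}\le1}\|f-R(f(t_1),\ldots,f(t_m))\|_X$, with $R$ ranging over all (not necessarily linear) maps; here $\Omega=[-1,1]$ for $\alpha=-\frac12$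 and $\Omega=(-1,1)$ for $\alpha=0$. $\log$ is the natural logarithm. *)

(* Defs.v *)
From HB Require Import structures.
From mathcomp Require Import all_boot all_order all_algebra.
From mathcomp Require Import all_classical all_reals all_analysis.
From mathcomp Require Import measurable_realfun complex.

Set Implicit Arguments.
Unset Strict Implicit.
Unset Printing Implicit Defensive.

Import Order.TTheory GRing.Theory Num.Theory.
Import numFieldNormedType.Exports.

Local Open Scope classical_set_scope.
Local Open Scope ring_scope.

Section gegenbauer_measure.
Context {R : realType}.
Implicit Types (alpha x : R) (A : set R).

Definition gegenbauer_weight alpha x : R := (1 - x ^+ 2) `^ alpha.

Definition gegenbauer_cst alpha : R :=
  (\int[lebesgue_measure]_(x in `[(-1 : R), 1]) gegenbauer_weight alpha x)^-1.

Definition gegenbauer_density alpha x : R :=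
  gegenbauer_cst alpha * gegenbauer_weight alpha x * \1_`[(-1 : R), 1] x.

(* A Borel measure on the whole line that is concentrated on [-1, 1]: L^2 of
   it is L^2([-1, 1]), functions on R being compared almost everywhere. *)
Definition gegenbauer_measure alpha (A : set (measurableTypeR R)) : \bar R :=
  (\int[lebesgue_measure]_(x in A) (gegenbauer_density alpha x)%:E)%E.

Lemma gegenbauer_density_ge0 alpha x : 0 <= gegenbauer_density alpha x.
Proof.
rewrite /gegenbauer_density !mulr_ge0 ?powR_ge0 ?indicE ?ler0n//.
by rewrite invr_ge0 Rintegral_ge0// => y _; exact: powR_ge0.
Qed.

Lemma measurable_gegenbauer_density alpha :
  measurable_fun setT (gegenbauer_density alpha).
Proof.
apply: measurable_funM; last exact: measurable_indic.
apply: measurable_funM => //.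
apply: (measurableT_comp (measurable_powR alpha)
  (g := fun x : R => 1 - x ^+ 2)).
by apply: measurable_funB => //; exact: exprn_measurable.
Qed.

Let gegenbauer_measure0 alpha : gegenbauer_measure alpha set0 = 0%E.
Proof. exact: integral_set0. Qed.

Let gegenbauer_measure_ge0 alpha A : (0 <= gegenbauer_measure alpha A)%E.
Proof. by apply: integral_ge0 => x _; rewrite lee_fin gegenbauer_density_ge0. Qed.

Let gegenbauer_measure_sigma_additive alpha :
  semi_sigma_additive (gegenbauer_measure alpha).
Proof.
apply: semi_sigma_additive_nng_induced => [|x].
  by apply/measurable_EFinP; exact: measurable_gegenbauer_density.
by rewrite lee_fin gegenbauer_density_ge0.
Qed.

HB.instance Definition _ alpha := isMeasure.Build _ _ _ (gegenbauer_measure alpha)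
  (gegenbauer_measure0 alpha) (gegenbauer_measure_ge0 alpha)
  (@gegenbauer_measure_sigma_additive alpha).

End gegenbauer_measure.

Section complex_L2.
Context {R : realType} (mu : {measure set (measurableTypeR R) -> \bar R}).
Implicit Types f g : R -> R[i].

Definition L2norm f : \bar R :=
  'N[mu]_2%:E[(fun x => (Normc.normc (f x))%:E)]%E.

Definition L2 : set (R -> R[i]) :=
  [set f | [/\ measurable_fun setT (fun x => complex.Re (f x)),
               measurable_fun setT (fun x => complex.Im (f x)) &
               (L2norm f < +oo)%E]].

Definition L2dot f g : R[i] :=
  ((\int[mu]_x complex.Re (f x * (g x)^*%C)) +i*
   (\int[mu]_x complex.Im (f x * (g x)^*%C)))%C.

End complex_L2.

Section orthonormal_polynomials.
Context {R : realType}.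
Implicit Types (alpha : R) (P : nat -> {poly R}).

Definition is_orthonormal_polys alpha P : Prop :=
  [/\ forall n, size (P n) = n.+1,
      forall n, 0 < lead_coef (P n) &
      forall m n, \int[gegenbauer_measure alpha]_x ((P m).[x] * (P n).[x])
                  = (m == n)%:R].

(* The default value 0 is irrelevant: for alpha > -1 there is exactly one
   sequence satisfying is_orthonormal_polys. *)
Definition gegenbauer_poly alpha : nat -> {poly R} :=
  xget (fun=> 0) [set P | is_orthonormal_polys alpha P].

End orthonormal_polynomials.

Section wiener_space.
Context {R : realType}.
Implicit Types (alpha r p : R) (f : R -> R[i]).

Definition gegenbauer_polyC alpha (n : nat) (x : R) : R[i] :=
  ((gegenbauer_poly alpha n).[x])%:C%C.

Definition gegenbauer_coef alpha f (n : nat) : R[i] :=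
  L2dot (gegenbauer_measure alpha) f (gegenbauer_polyC alpha n).

(* The orthonormal Legendre polynomials are not uniformly bounded at the end
   points, hence point values are only available in the open interval there. *)
Definition sample_domain alpha : set R :=
  if alpha == 0 then `](-1), 1[%classic else `[(-1), 1]%classic.

Definition wiener_norm alpha r p f : \bar R :=
  ((\sum_(0 <= n <oo)
      ((Normc.normc (gegenbauer_coef alpha f n) * (1 + n%:R) `^ r) `^ p)%:E)
    `^ (p^-1))%E.

(* Elements are functions, not classes: the last clause singles out the
   representative whose point values on the domain are those of the series. *)
Definition wiener_space alpha r p : set (R -> R[i]) :=
  [set f | [/\ L2 (gegenbauer_measure alpha) f,
               (wiener_norm alpha r p f < +oo)%E &
               forall x, sample_domain alpha x ->
                 series (fun n => gegenbauer_coef alpha f n * gegenbauer_polyC alpha n x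
                                  : R[i]^o)
                   @ \oo --> (f x : R[i]^o)]].

End wiener_space.

Section sampling_numbers.
Context {R : realType}.
Implicit Types (Omega : set R) (F X : set (R -> R[i])).

(* A normed space is passed as its underlying set of functions together with
   its norm; the unit ball of F is F `&` [set f | normF f <= 1]. *)
Definition sampling_number Omega F (normF : (R -> R[i]) -> \bar R)
    X (normX : (R -> R[i]) -> \bar R) (m : nat) : \bar R :=
  ereal_inf
    [set ereal_inf
      [set ereal_sup
        [set normX (fun x => f x - Rec (\row_i f (t i)) x)
          | f in F `&` [set f | (normF f <= 1)%E]]
      | Rec in [set Rec : 'rV[R[i]]_m -> (R -> R[i]) | forall y, X (Rec y)]]
    | t in [set t : 'I_m -> R | forall i, Omega (t i)]].

Definition wiener_sampling_number (alpha r p : R) (m : nat) : \bar R :=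
  sampling_number (sample_domain alpha)
    (wiener_space alpha r p) (wiener_norm alpha r p)
    (L2 (gegenbauer_measure alpha)) (L2norm (gegenbauer_measure alpha)) m.

End sampling_numbers.

(* Main.v *)
Require Import Defs.
From mathcomp Require Import all_boot all_order all_algebra.
From mathcomp Require Import all_classical all_reals all_analysis.
From mathcomp Require Import measurable_realfun complex ring lra.

(** The recovery map sends a sample vector to any element of the unit ball with
    these samples, so it suffices that two elements of the ball with equal
    samples are close in L^2.  Let b be the real or imaginary coefficients of
    their difference and h = \sum_(k < N) b_k p_k, with N polynomial in n.  For
    m >> s (log s)^2 log N random nodes,
      |b|_2^2 <= C (mean over the nodes of (1 - t^2)^(alpha + 1/2) h(t)^2)
                 + (C / s) |b|_1^2.
    To see this, normalise |b|_1 = 1 and cut the weighted function into level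
    sets |h| ~ 2^-l.  By Maurey's argument h is, up to 2^-l/4 and outside a small
    set, an average of about 4^l log s dictionary elements, and there are few
    enough such averages for a Chernoff bound to hold for all of them at once.
    The dictionary is bounded: (1 - x^2)^(alpha + 1/2) p_k(x)^2 is at most
    2 / mu(1), which comes from the Gegenbauer differential equation and
    Sonin-type monotone quantities.  At equal samples the mean only sees the tail
    of the expansion, while cutting b at height n^(-r - 1/p) gives
    |b|_1 <~ sqrt n |b|_2 + n^(1 - r - 1/p); for s a large multiple of n the
    first term is absorbed. *)

Set Implicit Arguments.
Unset Strict Implicit.
Unset Printing Implicit Defensive.

Import Order.TTheory GRing.Theory Num.Theory.
Import numFieldNormedType.Exports.
Import HBNNSimple.

Local Open Scope classical_set_scope.
Local Open Scope ring_scope.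

(** That m is linear in s up to logarithms rests on a cancellation of two powers of 4. At height
    2^-l the union bound runs over about exp(4^l nu ell) averages, but squared heights carry the
    weight 4^-l, so level sets of mass below about 4^l / s may be neglected, and the Chernoff
    exponent m 4^l / s beats the count on all levels at once. Nodes are drawn from a finite grid, so
    probabilities are weighted sums over finite functions. The grid may be arbitrarily fine: its
    size does not enter m, since the union bound counts averages of dictionary elements. In the
    Legendre case the weight that bounds the dictionary is compensated by drawing nodes with
    probability proportional to cell mass over weight; these ratios have a bounded sum because (1 -
    x^2)^(-1/2) is integrable. Hence both families get the rate n^(-(r + 1/p - 1/2)), and the
    Legendre claim follows with room to spare. Bounds on partial sums reach the function itself
    through Fatou's lemma and pointwise convergence on (-1, 1). *)

Section finite_sampling.
Context {R : realType}.

(** * Finite probability: Maurey averages, Chernoff bounds, level sets *)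

Lemma expR_le_quad (y : R) : y <= 2^-1 -> expR y <= 1 + y + 2 * y ^+ 2.
Proof.
move=> y12; have := expR_ge1Dx (- y); rewrite expRN => h.
have e0 := expR_gt0 y.
have {}h : (1 - y) * expR y <= 1 by rewrite -ler_pdivlMr // mul1r.
rewrite -(ler_pM2l (_ : 0 < 1 - y)); last by lra.
apply: (le_trans h).
have : 0 <= y ^+ 2 * (1 - 2 * y) by rewrite mulr_ge0 ?sqr_ge0 //; lra.
by lra.
Qed.

(** This factorisation is independence: a sum over [u] weighted by [\prod_i q (u i)] is an
    expectation over [a] independent draws from [q]. *)
Lemma sum_prod_ffun (I : finType) (a : nat) (F : I -> R) :
  \sum_(u : {ffun 'I_a -> I}) \prod_i F (u i) = (\sum_j F j) ^+ a.
Proof.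
rewrite -(bigA_distr_bigA (fun _ : 'I_a => F)).
by rewrite prodr_const card_ord.
Qed.

(** The draws are independent and centred. Deviations are at most 2, and |l| <= 1/4 keeps the
    exponent below 1/2, where the quadratic bound on exp contributes 2 (2 l)^2 = 8 l^2 per draw. *)
Lemma maurey_moment (I : finType) (q v : I -> R) (a : nat) (l : R) :
  (forall i, 0 <= q i) -> \sum_i q i = 1 -> (forall i, `|v i| <= 1) ->
  `|l| <= 4^-1 ->
  \sum_(u : {ffun 'I_a -> I}) (\prod_i q (u i)) *
     expR (l * \sum_i (v (u i) - \sum_j q j * v j))
  <= expR (8 * l ^+ 2 * a%:R).
Proof.
move=> q0 q1 v1 l4; set h := \sum_j q j * v j.
have h1 : `|h| <= 1.
  rewrite (le_trans (ler_norm_sum _ _ _)) // -q1; apply: ler_sum => i _.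
  by rewrite normrM ger0_norm // ler_piMr.
rewrite (eq_bigr (fun u : {ffun 'I_a -> I} =>
    \prod_i (q (u i) * expR (l * (v (u i) - h))))); last first.
  by move=> u _; rewrite mulr_sumr expR_sum -big_split.
rewrite (sum_prod_ffun a (fun i => q i * expR (l * (v i - h)))).
rewrite expRM_natr lerXn2r ?nnegrE ?expR_ge0 ?sumr_ge0 //.
  by move=> i _; rewrite mulr_ge0 ?expR_ge0.
apply: (le_trans _ (expR_ge1Dx _)).
apply: (@le_trans _ _ (\sum_i q i * (1 + l * (v i - h) + 8 * l ^+ 2))).
  apply: ler_sum => i _; rewrite ler_wpM2l //.
  have vh : `|v i - h| <= 2 by rewrite (le_trans (ler_normB _ _)) //; have := v1 i; lra.
  have lvh : `|l * (v i - h)| <= 2^-1.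
    rewrite normrM (le_trans (ler_pM _ _ l4 vh)) //; lra.
  apply: (le_trans (expR_le_quad _)); first by move: lvh; rewrite ler_norml => /andP[].
  rewrite lerD2l exprMn mulrCA [8 * _]mulrC ler_wpM2l ?sqr_ge0 //.
  suff : (v i - h) ^+ 2 <= 2 ^+ 2 by lra.
  by rewrite -[leLHS]real_normK ?num_real // lerXn2r ?nnegrE.
rewrite (eq_bigr (fun i => (1 - l * h + 8 * l ^+ 2) * q i + l * (q i * v i))); last first.
  by move=> i _; ring.
by rewrite big_split /= -!mulr_sumr q1 -/h; lra.
Qed.

Lemma maurey_tail (I : finType) (q v : I -> R) (a : nat) (eta : R) :
  (forall i, 0 <= q i) -> \sum_i q i = 1 -> (forall i, `|v i| <= 1) ->
  0 <= eta <= 4 ->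
  \sum_(u : {ffun 'I_a -> I})
     (\prod_i q (u i)) * (eta * a%:R < `|\sum_i (v (u i) - \sum_j q j * v j)|)%R%:R
  <= 2 * expR (- (a%:R * eta ^+ 2 / 32)).
Proof.
move=> q0 q1 v1 /andP[eta0 eta4]; set h := \sum_j q j * v j.
pose S (u : {ffun 'I_a -> I}) := \sum_i (v (u i) - h).
(* The minimiser of 8 l^2 - eta l, with value - eta^2 / 32; the condition eta <= 4 is |l| <= 1/4. *)
pose l : R := eta / 16.
have l4 : `|l| <= 4^-1 by rewrite ger0_norm /l; lra.
have lN4 : `|- l| <= 4^-1 by rewrite normrN.
apply: (@le_trans _ _ (expR (- (l * eta * a%:R)) *
  (\sum_(u : {ffun 'I_a -> I}) (\prod_i q (u i)) * expR (l * S u) +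
   \sum_(u : {ffun 'I_a -> I}) (\prod_i q (u i)) * expR (- l * S u)))).
  rewrite -big_split /= mulr_sumr; apply: ler_sum => u _.
  rewrite -mulrDr mulrCA ler_wpM2l ?prodr_ge0 // -/(S u) mulrDr -!expRD.
  case: ltP => [|_] /=; last by rewrite addr_ge0 ?expR_ge0.
  rewrite lter_normr => /orP[] hS.
    rewrite -[leLHS]addr0 lerD ?expR_ge0 // -[leLHS]expR0 ler_expR.
    have : 0 <= l * (S u - eta * a%:R) by rewrite mulr_ge0 /l; lra.
    by lra.
  rewrite -[leLHS]add0r lerD ?expR_ge0 // -[leLHS]expR0 ler_expR.
  have : 0 <= l * (- S u - eta * a%:R) by rewrite mulr_ge0 /l; lra.
  by lra.
have := maurey_moment a q0 q1 v1 l4.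
have := maurey_moment a q0 q1 v1 lN4.
rewrite sqrrN -/h => hN hP.
apply: (le_trans (ler_wpM2l (expR_ge0 _) (lerD hP hN))).
set E := expR (8 * _ * _).
rewrite (_ : _ * (E + E) = 2 * (expR (- (l * eta * a%:R)) * E)); last by ring.
by rewrite -expRD ler_wpM2l // ler_expR /l; lra.
Qed.

(** Exponential Markov inequality with parameter 1: as 1 - 1/e >= 1/2, one draw has mean of exp(-D)
    at most 1 - P/2 <= exp(-P/2), which leaves the exponent m P / 4 - m P / 2. *)
Lemma chernoff_lower (J : finType) (w : J -> R) (D : pred J) (m : nat) :
  (forall j, 0 <= w j) -> \sum_j w j = 1 ->
  \sum_(t : {ffun 'I_m -> J})
     (\prod_i w (t i)) * (4 * \sum_i (D (t i))%:R < m%:R * \sum_j w j * (D j)%:R)%R%:R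
  <= expR (- (m%:R * (\sum_j w j * (D j)%:R) / 4)).
Proof.
move=> p0 p1; set P := \sum_j w j * (D j)%:R.
have P0 : 0 <= P by rewrite sumr_ge0 // => j _; rewrite mulr_ge0.
apply: (@le_trans _ _ (expR (m%:R * P / 4) *
  \sum_(t : {ffun 'I_m -> J}) (\prod_i w (t i)) * expR (- \sum_i (D (t i))%:R))).
  rewrite [leRHS]mulr_sumr; apply: ler_sum => t _.
  rewrite mulrCA ler_wpM2l ?prodr_ge0 // -expRD.
  case: ltP => [hlt|_] /=; last exact: expR_ge0.
  by rewrite -[leLHS]expR0 ler_expR; lra.
rewrite (eq_bigr (fun t : {ffun 'I_m -> J} =>
    \prod_i (w (t i) * expR (- (D (t i))%:R)))); last first.
  by move=> t _; rewrite -sumrN expR_sum -big_split.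
rewrite (sum_prod_ffun m (fun j => w j * expR (- (D j)%:R))).
have -> : - (m%:R * P / 4) = m%:R * P / 4 + (- (P / 2) * m%:R) by lra.
rewrite expRD ler_wpM2l ?expR_ge0 // expRM_natr lerXn2r ?nnegrE ?expR_ge0 ?sumr_ge0 //.
  by move=> i _; rewrite mulr_ge0 ?expR_ge0.
apply: (le_trans _ (expR_ge1Dx _)).
apply: (@le_trans _ _ (\sum_j (w j - 2^-1 * (w j * (D j)%:R)))).
  apply: ler_sum => j _; rewrite mulrCA -[X in X - _]mulr1 -mulrBr ler_wpM2l //.
  case: (D j) => /=; last by rewrite oppr0 expR0; lra.
  have := expR_gt0 (1 : R); have := expR_ge1Dx (1 : R); rewrite expRN => h1 h2.
  have : 2^-1 * (expR (1:R) * (expR 1)^-1) >= (expR (1:R))^-1 :> R.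
    by rewrite mulrA ler_peMl ?invr_ge0 ?(ltW h2) //; lra.
  by rewrite divff ?gt_eqF //; lra.
by rewrite sumrB p1 -mulr_sumr -/P; lra.
Qed.

(** Union bound. The slack [p0 k] disposes of rare events: if [D k] has probability at most [p0 k]
    the inequality cannot fail, and otherwise the Chernoff bound is at most its value at [p0 k]. *)
Lemma exists_empirical_lower (K J : finType) (w : J -> R) (D : K -> pred J)
    (p0 : K -> R) (m : nat) :
  (forall j, 0 <= w j) -> \sum_j w j = 1 -> (forall k, 0 <= p0 k) ->
  \sum_k expR (- (m%:R * p0 k / 4)) < 1 ->
  exists t : {ffun 'I_m -> J}, forall k,
    m%:R * \sum_j w j * (D k j)%:R <= 4 * \sum_i (D k (t i))%:R + m%:R * p0 k.
Proof.
move=> w0 w1 p00 hK.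
pose P k := \sum_j w j * (D k j)%:R.
pose fail k (t : {ffun 'I_m -> J}) :=
  (4 * \sum_i (D k (t i))%:R + m%:R * p0 k < m%:R * P k)%R.
apply: contrapT => /forallNP hno.
have hfail (t : {ffun 'I_m -> J}) : exists k, fail k t.
  apply: contrapT => /forallNP nf; apply: (hno t) => k.
  by rewrite leNgt; apply/negP => /(nf k).
move: hK; rewrite ltNge => /negP; apply.
have W1 : \sum_(t : {ffun 'I_m -> J}) \prod_i w (t i) = 1.
  by rewrite (sum_prod_ffun m w) w1 expr1n.
rewrite -[leLHS]W1.
apply: (@le_trans _ _ (\sum_(t : {ffun 'I_m -> J})
    \sum_k (\prod_i w (t i)) * (fail k t)%:R)).
  apply: ler_sum => t _; have [k hk] := hfail t.
  rewrite (bigD1 k) //= hk mulr1 lerDl sumr_ge0 // => i _.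
  by rewrite mulr_ge0 ?prodr_ge0.
rewrite exchange_big /=; apply: ler_sum => k _.
have [Pp|Pp] := leP (m%:R * P k) (m%:R * p0 k).
  rewrite big1 ?expR_ge0 // => t _; rewrite [fail _ _](_ : _ = false) ?mulr0 //.
  apply/negbTE; rewrite -leNgt (le_trans Pp) // lerDr mulr_ge0 // sumr_ge0 //.
apply: (@le_trans _ _ (expR (- (m%:R * P k / 4)))); last by rewrite ler_expR; lra.
apply: (le_trans _ (chernoff_lower (D k) m w0 w1)).
apply: ler_sum => t _; rewrite ler_wpM2l ?prodr_ge0 // ler_nat.
have [f|//] := boolP (fail k t); rewrite lt0b; move: f; rewrite /fail /P => f.
by rewrite (le_lt_trans _ f) // lerDl mulr_ge0.
Qed.

Lemma exists_le_mean (I : finType) (q A : I -> R) (B : R) :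
  (forall i, 0 <= q i) -> \sum_i q i = 1 -> \sum_i q i * A i <= B ->
  exists i, A i <= B.
Proof.
move=> q0 q1 hB; apply: contrapT => /forallNP hno.
have AB i : B < A i by rewrite ltNge; apply/negP/hno.
have q_eq0 i : q i = 0.
  have h : \sum_i q i * (A i - B) <= 0.
    rewrite (eq_bigr (fun i => q i * A i - B * q i)); last by move=> ? _; ring.
    by rewrite sumrB -mulr_sumr q1; lra.
  have qAB0 k : 0 <= q k * (A k - B) by rewrite mulr_ge0 // subr_ge0 ltW.
  have /eqP : \sum_i q i * (A i - B) == 0 by rewrite eq_le h sumr_ge0.
  move/psumr_eq0P => /(_ (fun k _ => qAB0 k) i isT)/eqP.
  by rewrite mulf_eq0 subr_eq0 (gt_eqF (AB i)) orbF => /eqP.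
by move/eqP: q1; rewrite big1 // eq_sym oner_eq0.
Qed.

(** Exchanging sums, the expected [v]-mass of the bad points is bounded by the tail estimate at each
    point, and some [u] does no worse than the mean. The measure [v] is left free so that it can
    charge the grid and the nodes together. *)
Lemma maurey_exists (I X : finType) (v : X -> R) (psi : I -> X -> R)
    (q : I -> R) (a : nat) (eta : R) :
  (forall x, 0 <= v x) ->
  (forall i, 0 <= q i) -> \sum_i q i = 1 -> (forall i x, `|psi i x| <= 1) ->
  0 <= eta <= 4 ->
  exists u : {ffun 'I_a -> I},
    \sum_x v x * (eta * a%:R <
        `|\sum_k (psi (u k) x - \sum_j q j * psi j x)|)%R%:R
    <= (\sum_x v x) * (2 * expR (- (a%:R * eta ^+ 2 / 32))).
Proof.
move=> v0 q0 q1 psi1 heta.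
apply: (@exists_le_mean _ (fun u : {ffun 'I_a -> I} => \prod_k q (u k))).
- by move=> u; exact: prodr_ge0.
- by rewrite (sum_prod_ffun a q) q1 expr1n.
under eq_bigr do rewrite mulr_sumr.
rewrite exchange_big /= mulr_suml; apply: ler_sum => x _.
under eq_bigr do rewrite mulrCA.
by rewrite -mulr_sumr ler_wpM2l // maurey_tail.
Qed.

(** Induction by doubling: for v < 1 the claim for 2 v is the claim for v shifted by one level; for
    v >= 1 the term of level 0 is already 4 >= v^2. *)
Lemma sqr_le_levels (L : nat) (v : R) : 0 <= v <= 2 ->
  v ^+ 2 <= 4 * 4^-1 ^+ L + 4 * \sum_(l < L) 4^-1 ^+ l * (2^-1 ^+ l <= v)%R%:R.
Proof.
elim: L v => [|L IH] v /andP[v0 v2].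
  have : 0 <= (2 - v) * (2 + v) by rewrite mulr_ge0 //; lra.
  by rewrite big_ord0 expr0; lra.
rewrite big_ord_recl /= !expr0 mul1r.
have S0 : 0 <= \sum_(l < L) (4^-1 : R) ^+ lift ord0 l * (2^-1 ^+ lift ord0 l <= v)%R%:R.
  by apply: sumr_ge0 => l _; rewrite mulr_ge0 // exprn_ge0.
have p0 : 0 <= (4^-1 : R) ^+ L.+1 by rewrite exprn_ge0.
have [v1|v1] := leP 1 v.
  have : 0 <= (2 - v) * (2 + v) by rewrite mulr_ge0 //; lra.
  by rewrite [true%:R]mulr1n; move: S0 => /=; lra.
have /IH : 0 <= 2 * v <= 2 by lra.
rewrite (_ : (2 * v) ^+ 2 = 4 * v ^+ 2); last by ring.
rewrite /= add0r; set S := (X in _ <= _ + _ * X) => hS.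
rewrite [X in _ + 4 * X](_ : _ = 4^-1 * S); first by rewrite (exprS _ L); lra.
rewrite /S mulr_sumr; apply: eq_bigr => l _.
rewrite /bump /= add1n exprS -mulrA; congr (_ * (_ * (nat_of_bool _)%:R)).
by rewrite exprS; set x := 2^-1 ^+ l; apply/idP/idP; lra.
Qed.

Lemma sum_geo4_le2 (L : nat) : \sum_(l < L) (4^-1 : R) ^+ l <= 2.
Proof.
have := subrXX (1 : R) 4^-1 L.
rewrite expr1n (eq_bigr (fun i : 'I_L => (4^-1 : R) ^+ i)); last first.
  by move=> i _; rewrite expr1n mul1r.
have : 0 <= (4^-1 : R) ^+ L by rewrite exprn_ge0.
by lra.
Qed.

(** A converse comparison, again by doubling. The thresholds are 2^-(l+1) instead of 2^-l because a
    factor 2 in height is lost when passing through the averages. *)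
Lemma sum_levels_le (L : nat) (v : R) : 0 <= v ->
  \sum_(l < L) 4^-1 ^+ l * (2^-1 ^+ l.+1 <= v)%R%:R <= 8 * v ^+ 2.
Proof.
elim: L v => [|L IH] v v0; first by rewrite big_ord0 mulr_ge0 ?sqr_ge0.
have [vl|vl] := leP 2^-1 v.
  apply: (@le_trans _ _ 2); last by nra.
  apply: le_trans (sum_geo4_le2 L.+1).
  by apply: ler_sum => l _; rewrite ler_piMr ?exprn_ge0 ?lern1 ?leq_b1.
rewrite big_ord_recl /= expr1 [_ <= v]leNgt vl /= mulr0 add0r.
have /IH : 0 <= 2 * v by rewrite mulr_ge0.
rewrite (_ : (2 * v) ^+ 2 = 4 * v ^+ 2); last by ring.
set S := (X in X <= _) => hS.
rewrite [leLHS](_ : _ = 4^-1 * S); first by lra.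
rewrite /S mulr_sumr; apply: eq_bigr => l _.
rewrite /bump /= add1n exprS -mulrA; congr (_ * (_ * (nat_of_bool _)%:R)).
by rewrite exprS; set x := 2^-1 ^+ l.+1; apply/idP/idP; lra.
Qed.

(** Level l has at most exp(nu a_l) averages, and this exponent and the Chernoff exponent are both
    multiples of 4^l. The condition on m leaves at most exp(-L) per level, and L exp(-L) < 1. *)
Lemma level_union_bound (I : finType) (L m : nat) (a : 'I_L -> nat)
    (s nu ell : R) :
  0 < s -> 0 <= nu -> #|I|%:R <= expR nu ->
  (forall l, (a l)%:R = 512 * 4 ^+ l * ell) ->
  64 * s * L%:R * (512 * ell * nu + L%:R) <= m%:R ->
  \sum_(k : {l : 'I_L & {ffun 'I_(a l) -> I}})
    expR (- (m%:R * (4 ^+ tag k / (16 * s * L%:R)) / 4)) < 1.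
Proof.
move=> s0 nu0 Inu ha hm.
rewrite [ltLHS](_ : _ = \sum_(l < L) \sum_(u : {ffun 'I_(a l) -> I})
    expR (- (m%:R * (4 ^+ l / (16 * s * L%:R)) / 4))); last by rewrite sig_big_dep.
apply: (@le_lt_trans _ _ (\sum_(l < L) expR (- L%:R))); last first.
  rewrite sumr_const card_ord -[ltLHS]mulr_natl expRN.
  rewrite ltr_pdivrMr ?expR_gt0 // mul1r.
  by have := expR_ge1Dx (L%:R : R); lra.
apply: ler_sum => l _.
have L0 : 0 < L%:R :> R by rewrite ltr0n (leq_ltn_trans (leq0n l)).
rewrite sumr_const card_ffun card_ord -[leLHS]mulr_natl natrX.
apply: (@le_trans _ _ (expR (nu * (a l)%:R) *
   expR (- (m%:R * (4 ^+ l / (16 * s * L%:R)) / 4)))).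
  by rewrite ler_wpM2r ?expR_ge0 // expRM_natr lerXn2r ?nnegrE ?expR_ge0.
rewrite -expRD ler_expR ha.
have -> : m%:R * (4 ^+ l / (16 * s * L%:R)) / 4 = 4 ^+ l * (m%:R / (64 * s * L%:R)).
  by field; rewrite !gt_eqF.
have : 512 * ell * nu + L%:R <= m%:R / (64 * s * L%:R).
  by rewrite ler_pdivlMr ?mulr_gt0 // mulrC.
set Q := m%:R / _ => hQ.
have l1 : 1 <= 4 ^+ l :> R by rewrite exprn_ege1 // ler1n.
have : 4 ^+ l * (512 * ell * nu + L%:R) <= 4 ^+ l * Q.
  by rewrite ler_wpM2l // exprn_ge0.
have : L%:R <= 4 ^+ l * L%:R :> R by rewrite ler_peMl // ltW.
by lra.
Qed.

Lemma norm_convex_comb_le1 (I : finType) (q v : I -> R) :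
  (forall i, 0 <= q i) -> \sum_i q i = 1 -> (forall i, `|v i| <= 1) ->
  `|\sum_i q i * v i| <= 1.
Proof.
move=> q0 q1 v1; rewrite (le_trans (ler_norm_sum _ _ _)) // -q1.
by apply: ler_sum => i _; rewrite normrM ger0_norm // ler_piMr.
Qed.

(* On level l the convex combination h is compared with an average of [a l]
   dictionary elements, good on all but a small fraction both of J and of the
   nodes; each of these averages passes the Chernoff bound at the nodes. *)
Lemma finite_sampling (I J : finType) (w : J -> R) (psi : I -> J -> R)
    (s nu : R) (L ell m : nat) :
  (forall j, 0 <= w j) -> \sum_j w j = 1 ->
  (forall i j, `|psi i j| <= 1) ->
  0 < s -> 0 <= nu -> #|I|%:R <= expR nu ->
  8 * s <= 4 ^+ L -> (0 < ell)%N -> 512 * s <= expR ell%:R -> (0 < m)%N ->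
  64 * s * L%:R * (512 * ell%:R * nu + L%:R) <= m%:R ->
  exists t : 'I_m -> J, forall q : I -> R,
    (forall i, 0 <= q i) -> \sum_i q i = 1 ->
    \sum_j w j * (\sum_i q i * psi i j) ^+ 2 <=
    128 * (m%:R^-1 * \sum_k (\sum_i q i * psi i (t k)) ^+ 2) + s^-1.
Proof.
move=> w0 w1 psi1 s0 nu0 Inu hL ell0 hell m0 hm.
(* With accuracy eta = 2^-l / 4 the tail exponent a_l eta^2 / 32 is exactly [ell], whence 512 = 16 *
   32. *)
pose a (l : 'I_L) := (512 * 4 ^ l * ell)%N.
have aE l : (a l)%:R = 512 * 4 ^+ l * ell%:R :> R by rewrite /a !natrM natrX.
pose K := {l : 'I_L & {ffun 'I_(a l) -> I}}.
pose p0 (k : K) : R := 4 ^+ tag k / (16 * s * L%:R).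
(* The threshold 3/4 2^-l is at distance 2^-l / 4 from both 2^-l and 2^-(l+1): an average of that
   accuracy leads from |h| >= 2^-l on the grid to |h| >= 2^-(l+1) at the nodes. *)
pose D (l : 'I_L) (u : {ffun 'I_(a l) -> I}) : pred J := fun j =>
  3 / 4 * 2^-1 ^+ l * (a l)%:R <= `|\sum_k psi (u k) j|.
have p00 k : 0 <= p0 k.
  by rewrite /p0 divr_ge0 ?exprn_ge0 ?mulr_ge0 // ltW.
have [t ht] := exists_empirical_lower (fun k : K => D (tag k) (tagged k)) w0 w1 p00
  (level_union_bound s0 nu0 Inu aE hm).
exists t => q q0 q1.
pose h j := \sum_i q i * psi i j.
have h1 j : `|h j| <= 1 by apply: norm_convex_comb_le1.
have m0R : 0 < m%:R :> R by rewrite ltr0n.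
have level (l : 'I_L) : \sum_j w j * (2^-1 ^+ l <= `|h j|)%R%:R <=
    4 * (m%:R^-1 * \sum_k (2^-1 ^+ l.+1 <= `|h (t k)|)%R%:R)
    + 4 ^+ l / (16 * s * L%:R) + (32 * s)^-1.
  (* One measure on the disjoint union of grid and nodes, with mass 1 on each, so that a single [u]
     is accurate on both; its total bad mass is at most 4 / (512 s). *)
  pose v (x : J + 'I_m) : R := match x with inl j => w j | inr _ => m%:R^-1 end.
  pose pt (x : J + 'I_m) : J := match x with inl j => j | inr k => t k end.
  have v0 x : 0 <= v x by case: x => [j|k] /=; rewrite ?w0 ?invr_ge0 ?ltW.
  have eta4 : 0 <= (2^-1 : R) ^+ l / 4 <= 4.
    rewrite divr_ge0 ?exprn_ge0 //=.
    have : (2^-1 : R) ^+ l <= 1 by rewrite exprn_ile1 //; lra.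
    by lra.
  have [u hu] := maurey_exists (psi := fun i x => psi i (pt x)) (a l) v0 q0 q1
    (fun i x => psi1 i (pt x)) eta4.
  pose bad x : bool := 2^-1 ^+ l / 4 * (a l)%:R <
     `|\sum_k (psi (u k) (pt x) - h (pt x))|.
  have a0 : 0 < (a l)%:R :> R by rewrite ltr0n /a !muln_gt0 expn_gt0 ell0.
  have sumE x : \sum_k (psi (u k) (pt x) - h (pt x)) =
      \sum_k psi (u k) (pt x) - (a l)%:R * h (pt x).
    by rewrite sumrB sumr_const card_ord mulr_natl.
  have l0 : 0 < (2^-1 : R) ^+ l by rewrite exprn_gt0.
  have AD x : (2^-1 ^+ l <= `|h (pt x)|)%R%:R <= (D l u (pt x))%:R + (bad x)%:R :> R.
    have [b|nb] := boolP (bad x); first by rewrite -natrD ler_nat; case: (D _ _ _); case: (_ <= _).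
    rewrite -natrD ler_nat addn0; have [hx|//] := boolP (2^-1 ^+ l <= `|h (pt x)|)%R.
    rewrite lt0b /D.
    move: nb; rewrite /bad -leNgt sumE.
    have := lerB_dist ((a l)%:R * h (pt x)) (\sum_k psi (u k) (pt x)).
    rewrite distrC normrM (ger0_norm (ltW a0)) => h3 h4.
    have : (a l)%:R * 2^-1 ^+ l <= (a l)%:R * `|h (pt x)| by rewrite ler_wpM2l // ltW.
    by lra.
  have DB x : (D l u (pt x))%:R <= (2^-1 ^+ l.+1 <= `|h (pt x)|)%R%:R + (bad x)%:R :> R.
    have [b|nb] := boolP (bad x); first by rewrite -natrD ler_nat; case: (D _ _ _); case: (_ <= _).
    rewrite -natrD ler_nat addn0; have [Dx|//] := boolP (D _ _ _); rewrite lt0b.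
    move: nb Dx; rewrite /bad /D -leNgt sumE => nb Dx.
    have := lerB_dist (\sum_k psi (u k) (pt x)) ((a l)%:R * h (pt x)).
    rewrite [X in _ - X]normrM (ger0_norm (ltW a0)) => h3.
    rewrite -(ler_pM2l a0) exprS.
    by lra.
  have ea : expR (- ((a l)%:R * (2^-1 ^+ l / 4) ^+ 2 / 32)) <= (512 * s)^-1.
    rewrite aE (_ : _ / 32 = (4 ^+ l * (2^-1 ^+ l) ^+ 2) * ell%:R); last by field.
    rewrite -exprM mulnC exprM -exprMn (_ : 4 * 2^-1 ^+ 2 = 1); last by field.
    have s512 : 0 < 512 * s by apply: mulr_gt0 s0; exact: ltr0n.
    by rewrite expr1n mul1r expRN lef_pV2 ?posrE ?expR_gt0.
  move: hu; rewrite !big_sumType /= w1 sumr_const card_ord.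
  rewrite -[m%:R^-1 *+ m]mulr_natr mulVf ?gt_eqF // => hu.
  set Bw := \sum_j w j * _ in hu; set Bt := \sum_(i < m) _ in hu.
  have Bw0 : 0 <= Bw by apply: sumr_ge0 => j _; rewrite mulr_ge0.
  have h1' : \sum_j w j * (2^-1 ^+ l <= `|h j|)%R%:R <=
      \sum_j w j * (D l u j)%:R + Bw.
    rewrite -big_split /=; apply: ler_sum => j _.
    by rewrite -mulrDr ler_wpM2l //; exact: (AD (inl j)).
  have h2' : m%:R^-1 * \sum_k (D l u (t k))%:R <=
      m%:R^-1 * (\sum_k (2^-1 ^+ l.+1 <= `|h (t k)|)%R%:R) + Bt.
    rewrite !mulr_sumr -big_split /=; apply: ler_sum => k _.
    by rewrite -mulrDr ler_wpM2l ?invr_ge0 ?(ltW m0R) //; exact: (DB (inr k)).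
  have := ht (Tagged (fun l : 'I_L => {ffun 'I_(a l) -> I}) u).
  rewrite /= -(ler_pM2l (_ : 0 < m%:R^-1)) ?invr_gt0 // mulrDr !mulKf ?gt_eqF //.
  rewrite /p0 /= [m%:R^-1 * (4 * _)]mulrCA => h3'.
  have : (512 * s)^-1 = (32 * s)^-1 / 16 by field; rewrite gt_eqF.
  by move: ea hu; set e := expR _; lra.
apply: (@le_trans _ _ (4 * 4^-1 ^+ L + 4 * \sum_(l < L) 4^-1 ^+ l *
    \sum_j w j * (2^-1 ^+ l <= `|h j|)%R%:R)).
  rewrite (eq_bigr (fun l : 'I_L => \sum_j w j *
      (4^-1 ^+ l * (2^-1 ^+ l <= `|h j|)%R%:R))); last first.
    by move=> l _; rewrite mulr_sumr; apply: eq_bigr => j _; rewrite mulrCA.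
  have -> : 4 * 4^-1 ^+ L = \sum_j w j * (4 * 4^-1 ^+ L) by rewrite -mulr_suml w1 mul1r.
  rewrite exchange_big mulr_sumr -big_split.
  apply: ler_sum => j _ /=; rewrite -mulr_sumr [4 * (w j * _)]mulrCA -mulrDr ler_wpM2l //.
  by rewrite -real_normK ?num_real // sqr_le_levels // normr_ge0 (le_trans (h1 j)) ?ler1n.
apply: (@le_trans _ _ (4 * 4^-1 ^+ L + 4 * \sum_(l < L) (4^-1 ^+ l *
   (4 * (m%:R^-1 * \sum_k (2^-1 ^+ l.+1 <= `|h (t k)|)%R%:R)) +
   (16 * s * L%:R)^-1 + 4^-1 ^+ l * (32 * s)^-1))).
  rewrite lerD2l ler_wpM2l //; apply: ler_sum => l _.
  apply: (le_trans (ler_wpM2l _ (level l))); first by rewrite exprn_ge0.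
  rewrite !mulrDr [_ * (4 ^+ l / _)]mulrA -exprMn mulVf ?gt_eqF //.
  by rewrite expr1n mul1r.
rewrite !big_split /= -mulr_suml sumr_const card_ord.
have t1 : \sum_(l < L) 4^-1 ^+ l *
   (4 * (m%:R^-1 * \sum_k (2^-1 ^+ l.+1 <= `|h (t k)|)%R%:R)) <=
   32 * (m%:R^-1 * \sum_k (h (t k)) ^+ 2).
  rewrite (eq_bigr (fun l : 'I_L => 4 * m%:R^-1 * \sum_k
     4^-1 ^+ l * (2^-1 ^+ l.+1 <= `|h (t k)|)%R%:R)); last first.
    by move=> l _; rewrite -mulr_sumr; ring.
  rewrite -mulr_sumr exchange_big /=.
  have : \sum_(k < m) \sum_(l < L) 4^-1 ^+ l * (2^-1 ^+ l.+1 <= `|h (t k)|)%R%:R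
      <= 8 * \sum_k h (t k) ^+ 2.
    rewrite mulr_sumr; apply: ler_sum => k _.
    by rewrite -[X in _ * X]real_normK ?num_real // sum_levels_le.
  move=> hh; have : 0 <= 4 * m%:R^-1 :> R by rewrite mulr_ge0 // invr_ge0.
  by move/ler_wpM2l => /(_ _ _ hh); lra.
have t2 : (16 * s * L%:R)^-1 *+ L <= (16 * s)^-1.
  rewrite -[leLHS]mulr_natr invfM.
  have [->|Ln0] := eqVneq L%:R (0 : R); first by rewrite mulr0 invr_ge0 mulr_ge0 // ltW.
  by rewrite -mulrA mulVf // mulr1.
have t3 : (\sum_(l < L) (4^-1 : R) ^+ l) * (32 * s)^-1 <= 2 * (32 * s)^-1.
  by rewrite ler_wpM2r ?sum_geo4_le2 // invr_ge0 mulr_ge0 // ltW.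
have t4 : (4^-1 : R) ^+ L <= (8 * s)^-1.
  by rewrite exprVn lef_pV2 // posrE ?exprn_gt0 ?mulr_gt0.
(* With the outer factor 4 the error terms are at most 1 / (4 s), 1 / (4 s) and 1 / (2 s), which add
   up to 1 / s. *)
have e1 : (16 * s)^-1 = 16^-1 * s^-1 by rewrite invfM.
have e2 : (32 * s)^-1 = 32^-1 * s^-1 by rewrite invfM.
have e3 : (8 * s)^-1 = 8^-1 * s^-1 by rewrite invfM.
move: t1 t2 t3 t4; rewrite e1 e2 e3; lra.
Qed.

End finite_sampling.

(** * Integration against a measure given by a density *)

Section density.
Context d (T : measurableType d) (R : realType).
Variables (mu nu : {measure set T -> \bar R}) (g : T -> R).
Hypothesis g0 : forall x, 0 <= g x.
Hypothesis mg : measurable_fun setT g.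
Hypothesis nuE : forall A, measurable A -> nu A = (\int[mu]_(x in A) (g x)%:E)%E.
Local Open Scope ereal_scope.

(** For indicators this is [nuE]; simple functions follow by linearity, and the general case by
    monotone convergence on both sides. *)
Lemma ge0_integral_density (f : T -> \bar R) :
  (forall x, 0 <= f x) -> measurable_fun setT f ->
  \int[nu]_x f x = \int[mu]_x (f x * (g x)%:E).
Proof.
move=> f0 mf; pose h := nnsfun_approx measurableT mf.
have mgE : measurable_fun setT (EFin \o g) by exact/measurable_EFinP.
have hlim x : (EFin \o h n) x @[n --> \oo] --> f x by exact: cvg_nnsfun_approx.
have hnd x : {homo (fun n => (h n x)%:E) : a b / (a <= b)%N >-> a <= b}.
  by move=> a b ab; rewrite lee_fin; exact/lefP/nd_nnsfun_approx.
have fl x : f x = lim ((EFin \o h n) x @[n --> \oo]) by apply/esym/cvg_lim.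
have fgl x : f x * (g x)%:E = lim (((h n x)%:E * (g x)%:E) @[n --> \oo]).
  by apply/esym/cvg_lim => //; apply: cvgeZr => //; exact: hlim.
under eq_integral do rewrite fl.
under [RHS]eq_integral do rewrite fgl.
rewrite !monotone_convergence //; last first.
- by move=> x _ a b ab; exact: hnd.
- by move=> n x _; rewrite lee_fin.
- by move=> n; apply/measurable_EFinP.
- by move=> x _ a b ab; rewrite lee_wpmul2r ?lee_fin// -lee_fin hnd.
- by move=> n x _; rewrite mule_ge0 ?lee_fin.
- by move=> n; apply: emeasurable_funM => //; exact/measurable_EFinP.
suff suf n : \int[nu]_x (h n x)%:E = \int[mu]_x ((h n x)%:E * (g x)%:E).
  by under eq_fun do rewrite suf.
transitivity (\int[nu]_x (\sum_(y \in range (h n)) (y * \1_(h n @^-1` [set y]) x)%:E)).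
  by apply: eq_integral => t _; rewrite /= fimfunE -fsumEFin.
transitivity (\int[mu]_x (\sum_(y \in range (h n))
    (y * \1_(h n @^-1` [set y]) x)%:E * (g x)%:E)); last first.
  apply: eq_integral => x _; rewrite -ge0_mule_fsuml; last first.
    by move=> y; exact: nnfun_muleindic_ge0.
  by rewrite fsumEFin // -fimfunE.
have mind r : measurable_fun setT (fun x => (r * \1_(h n @^-1` [set r]) x)%:E).
  by apply/measurable_EFinP; exact: measurable_funM.
rewrite !ge0_integral_fsum //; last 3 first.
- by move=> y; apply: emeasurable_funM.
- by move=> y x _; apply: mule_ge0; [exact: nnfun_muleindic_ge0|rewrite lee_fin].
- by move=> y x _; exact: nnfun_muleindic_ge0.
apply: eq_fsbigr => r; rewrite inE => -[x0 _ <-].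
set A := h n @^-1` _.
have mA : measurable A by exact: measurable_sfunP.
under eq_integral do rewrite EFinM.
under [RHS]eq_integral do rewrite EFinM -muleA.
rewrite !ge0_integralZl ?lee_fin//.
- rewrite integral_indic// setIT nuE//; congr (_ * _).
  under [RHS]eq_integral do rewrite muleC.
  by rewrite integral_mkcond; apply: eq_integral => x _; rewrite epatch_indic.
- by apply: emeasurable_funM => //; exact/measurable_EFinP.
- by move=> x _; rewrite mule_ge0 ?lee_fin.
- exact/measurable_EFinP.
Qed.

Lemma integrable_density (f : T -> R) : measurable_fun setT f ->
  nu.-integrable setT (EFin \o f) ->
  mu.-integrable setT (fun x => (f x * g x)%:E).
Proof.
move=> mf /integrableP[_ fi]; apply/integrableP; split.
  by apply/measurable_EFinP; exact: measurable_funM.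
rewrite ge0_integral_density// in fi; last first.
  by apply: measurableT_comp => //; exact/measurable_EFinP.
apply: le_lt_trans fi; rewrite le_eqVlt; apply/orP; left; apply/eqP.
by apply: eq_integral => x _; rewrite /= -EFinM normrM (ger0_norm (g0 x)).
Qed.

Lemma Rintegral_density (f : T -> R) : measurable_fun setT f ->
  (\int[nu]_x f x = \int[mu]_x (f x * g x))%R.
Proof.
move=> mf; rewrite /Rintegral; congr fine.
rewrite integralE [RHS]integralE; congr (_ - _).
- rewrite ge0_integral_density//; last first.
    by apply: measurable_funepos; exact/measurable_EFinP.
  apply: eq_integral => x _; rewrite !funeposE /= -!EFin_max -EFinM.
  by rewrite maxr_pMl// mul0r.
- rewrite ge0_integral_density//; last first.
    by apply: measurable_funeneg; exact/measurable_EFinP.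
  apply: eq_integral => x _; rewrite !funenegE /= -!EFin_max -EFinM.
  by rewrite maxr_pMl// mul0r mulNr.
Qed.

End density.

Lemma measurable_horner (R : realType) (p : {poly R}) :
  measurable_fun setT (fun x : measurableTypeR R => p.[x]).
Proof. by apply: continuous_measurable_fun; exact: continuous_horner. Qed.

Lemma poly_span_size (F : fieldType) (P : nat -> {poly F}) :
  (forall n, size (P n) = n.+1) ->
  forall n (p : {poly F}), (size p <= n)%N ->
  exists c : nat -> F, p = \sum_(k < n) c k *: P k.
Proof.
move=> sP; elim => [|n IH] p sp.
  by exists (fun=> 0); rewrite big_ord0; apply/eqP; rewrite -size_poly_leq0.
have lP : (P n)`_n != 0 by have := lead_coefE (P n); rewrite sP /= => <-; rewrite lead_coef_eq0 -size_poly_eq0 sP.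
pose a := p`_n / (P n)`_n.
have /IH[c hc] : (size (p - a *: P n)%R <= n)%N.
  apply/leq_sizeP => j; rewrite leq_eqVlt => /predU1P[<-|nj].
    by rewrite coefB coefZ divfK // subrr.
  by rewrite coefB coefZ !nth_default ?mulr0 ?subr0 ?sP // (leq_trans sp).
exists (fun k => if k == n then a else c k).
rewrite big_ord_recr /= eqxx -[LHS](subrK (a *: P n)) hc; congr (_ + _).
by apply: eq_bigr => k _; rewrite ltn_eqF.
Qed.

(** * Integrals of polynomials, from orthonormality *)

Section orthonormal_polynomials.
Context {R : realType} (alpha : R) (P : nat -> {poly R}).
Hypothesis HP : is_orthonormal_polys alpha P.

Notation mu := (gegenbauer_measure alpha).
Notation L p := (\int[mu]_x (p : {poly R}).[x]).

Let sP n : size (P n) = n.+1. Proof. by case: HP. Qed.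
Let dP m n : \int[mu]_x ((P m).[x] * (P n).[x]) = (m == n)%:R.
Proof. by case: HP. Qed.

(** Integrability is read off the normalisation: [fine] would send an infinite integral to 0,
    whereas the integral of P_n^2 is 1. *)
Lemma orthonormal_sqr_integrable n :
  mu.-integrable setT (fun x => ((P n).[x] ^+ 2)%:E).
Proof.
have mf : measurable_fun setT (fun x : measurableTypeR R => (P n).[x] ^+ 2).
  by apply: measurable_funX; exact: measurable_horner.
apply/integrableP; split; first exact/measurable_EFinP.
under eq_integral do rewrite gee0_abs ?lee_fin ?sqr_ge0//.
rewrite ltey; apply/eqP => h; have := dP n n.
rewrite /Rintegral eqxx; under eq_integral do rewrite -expr2.
by rewrite h /= => /esym/eqP; rewrite oner_eq0.
Qed.

Lemma orthonormal_mul_integrable m n :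
  mu.-integrable setT (fun x => ((P m).[x] * (P n).[x])%:E).
Proof.
apply: (@le_integrable _ _ _ mu setT measurableT _
  (fun x : measurableTypeR R => ((P m).[x] ^+ 2)%:E + ((P n).[x] ^+ 2)%:E)%E) => //.
- by apply/measurable_EFinP; apply: measurable_funM; exact: measurable_horner.
- move=> x _; rewrite -EFinD !abse_EFin lee_fin [leRHS]ger0_norm ?addr_ge0 ?sqr_ge0 //.
  rewrite ler_norml; apply/andP; split.
    have := sqr_ge0 ((P m).[x] + (P n).[x]).
    by have := sqr_ge0 ((P m).[x]); have := sqr_ge0 ((P n).[x]); lra.
  have := sqr_ge0 ((P m).[x] - (P n).[x]).
  by have := sqr_ge0 ((P m).[x]); have := sqr_ge0 ((P n).[x]); lra.
- by apply: integrableD => //; exact: orthonormal_sqr_integrable.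
Qed.

(** P_0 is a nonzero constant, so any polynomial is a combination of the products P_k P_0, which are
    known to be integrable. *)
Lemma poly_integrable (p : {poly R}) : mu.-integrable setT (fun x => (p.[x])%:E).
Proof.
have [c pE] := poly_span_size sP (leqnn (size p)).
have [a a0 P0] : exists2 a, a != 0 & P 0 = a%:P.
  have /eqP/size_poly1P[a a0 ->] := sP 0; by exists a.
have -> : (fun x => (p.[x])%:E) = (fun x => \sum_(k < size p)
    (a^-1 * c k)%:E * ((P k).[x] * (P 0).[x])%:E)%E.
  apply/funext => x; rewrite {1}pE horner_sum sumEFin; congr EFin.
  by apply: eq_bigr => k _; rewrite P0 hornerC hornerZ; field.
apply: integrable_sum => // k _; apply: integrableZl => //.
exact: orthonormal_mul_integrable.
Qed.

Lemma gintD (p q : {poly R}) : L (p + q) = L p + L q.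
Proof.
under eq_Rintegral do rewrite hornerD.
by rewrite RintegralD //; exact: poly_integrable.
Qed.

Lemma gintZ a (p : {poly R}) : L (a *: p) = a * L p.
Proof.
under eq_Rintegral do rewrite hornerZ.
by rewrite RintegralZl //; exact: poly_integrable.
Qed.

Lemma gintN (p : {poly R}) : L (- p) = - L p.
Proof. by rewrite -scaleN1r gintZ mulN1r. Qed.

Lemma gintB (p q : {poly R}) : L (p - q) = L p - L q.
Proof. by rewrite gintD gintN. Qed.

Lemma gint0 : L 0 = 0.
Proof. by rewrite -(scale0r 0) gintZ mul0r. Qed.

Lemma gint_sum (I : Type) (r : seq I) (Q : pred I) (F : I -> {poly R}) :
  L (\sum_(i <- r | Q i) F i) = \sum_(i <- r | Q i) L (F i).
Proof. exact: (big_morph (fun p : {poly R} => L p) gintD gint0). Qed.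

Lemma gint_orth m n : L (P m * P n) = (m == n)%:R.
Proof. by under eq_Rintegral do rewrite hornerM; exact: dP. Qed.

Lemma gint_orth_lt (p : {poly R}) n : (size p <= n)%N -> L (P n * p) = 0.
Proof.
move=> /(poly_span_size sP)[c ->]; rewrite mulr_sumr gint_sum big1 // => k _.
by rewrite -scalerAr gintZ gint_orth gtn_eqF // mulr0.
Qed.

Lemma gint1_gt0 : 0 < L 1.
Proof.
have [a a0 P0] : exists2 a, a != 0 & P 0 = a%:P.
  have /eqP/size_poly1P[a a0 ->] := sP 0; by exists a.
have : a ^+ 2 * L 1 = 1.
  by rewrite -gintZ -[RHS](gint_orth 0 0) P0 -polyCM -mul_polyC mulr1.
have a2 : 0 < a ^+ 2 by rewrite exprn_even_gt0.
by move=> h; rewrite -(pmulr_rgt0 _ a2) h.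
Qed.

End orthonormal_polynomials.

(** * The Gegenbauer differential equation *)

Lemma is_derive_horner (R : realType) (p : {poly R}) (x : R) :
  is_derive x 1 (horner p) (p^`()).[x].
Proof.
apply: DeriveDef; first exact: derivable_horner.
by rewrite derivE derive1E.
Qed.

(* The antiderivative need not be differentiable at the end points, where f
   may blow up. *)
Lemma Rintegral_FTC_open (R : realType) (f F : R -> R) (a b : R) : a < b ->
  lebesgue_measure.-integrable `[a, b] (EFin \o f) ->
  (forall x, x \in `]a, b[ -> {for x, continuous f}) ->
  {within `[a, b], continuous F} ->
  (forall x, x \in `]a, b[ -> is_derive x 1 F (f x)) ->
  \int[lebesgue_measure]_(x in `[a, b]) f x = F b - F a.
Proof.
move=> ab fi fc Fc F'.
pose G x := \int[lebesgue_measure]_(t in `[a, x]) f t.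
have Gc : {within `[a, b], continuous G}.
  exact: (parameterized_integral_continuous (ltW ab) fi).
have [||c _ /=] := @MVT _ (G - F) (fun=> 0) a b ab.
- move=> x xab; have [ax xb] : a < x /\ x < b by move: (xab); rewrite in_itv /= => /andP.
  have [dG G'] := continuous_FTC1_closed xb fi ax (fc x xab).
  have dFx := F' x xab.
  apply: (@is_derive_eq _ _ _ _ _ _ _ (f x - f x)); last by rewrite subrr.
  have dGx : is_derive x 1 G (f x) by apply: DeriveDef dG _; rewrite -derive1E.
  exact: is_deriveB.
- by move=> x; apply: continuousB; [exact: Gc|exact: Fc].
rewrite mul0r !fctE /G set_itv1 Rintegral_set1 => h.
by lra.
Qed.

Section orthonormal_polynomials.
Context {R : realType} (alpha : R) (P : nat -> {poly R}).
Hypothesis HP : is_orthonormal_polys alpha P.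

Notation mu := (gegenbauer_measure alpha).
Notation L p := (\int[mu]_x (p : {poly R}).[x]).

(** Against the density, the integrand is up to a constant the derivative of (1 - x^2)^(alpha + 1)
    q, which vanishes at both end points. [phi] is a continuous function on the whole line that
    agrees with y^(alpha + 1) for y >= 0; it supplies continuity up to the end points. *)
Lemma gint_divergence (phi : R -> R) (q : {poly R}) :
  continuous phi -> (forall y : R, 0 <= y -> phi y = y `^ (alpha + 1)) ->
  alpha + 1 != 0 ->
  L ((1 - 'X^2) * q^`() - (2 * (alpha + 1)) *: ('X * q)) = 0.
Proof.
move=> cphi phiE alpha1; set r := _ - _.
have mr : measurable_fun setT (fun x : measurableTypeR R => r.[x]).
  exact: measurable_horner.
have ir := @integrable_density _ (measurableTypeR R) R lebesgue_measure mu _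
  (gegenbauer_density_ge0 alpha) (measurable_gegenbauer_density alpha)
  (fun _ _ => erefl) _ mr (poly_integrable HP r).
rewrite (@Rintegral_density _ (measurableTypeR R) R lebesgue_measure mu _
  (gegenbauer_density_ge0 alpha) (measurable_gegenbauer_density alpha)
  (fun _ _ => erefl) _ mr).
have qE : (fun x : R => 1 - x ^+ 2) = horner (1 - 'X^2).
  by apply/funext => x; rewrite !hornerE.
pose c : R := gegenbauer_cst alpha.
pose f x := r.[x] * (c * (1 - x ^+ 2) `^ alpha).
have fE : (fun x => r.[x] * gegenbauer_density alpha x) = f \_ `[(-1), 1].
  apply/funext => x; rewrite patchE /gegenbauer_density indicE mulrA.
  by case: (x \in _); rewrite ?mulr1 ?mulr0.
rewrite fE -Rintegral_mkcond; change (is_true (lebesgue_measure.-integrable setT (EFin \o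
  (fun x : R => r.[x] * gegenbauer_density alpha x)))) in ir.
rewrite {}fE in ir.
have fi : lebesgue_measure.-integrable `[(-1), 1] (EFin \o f).
  by apply/integrable_mkcond => //; rewrite restrict_EFin.
pose F (x : R) := c * (1 - x ^+ 2) `^ (alpha + 1) * q.[x].
transitivity (F 1 - F (-1)); last first.
  rewrite /F expr1n sqrrN expr1n subrr powR0 //.
  by rewrite !mulr0 !mul0r subrr.
apply: Rintegral_FTC_open => //.
- move=> x; rewrite in_itv /= => /andP[x1 x2].
  have x0 : 0 < 1 - x ^+ 2 by nra.
  apply: continuousM; first exact: continuous_horner.
  apply: continuousM; first exact: cst_continuous.
  apply: (@continuous_comp _ _ _ (fun x : R => 1 - x ^+ 2) (fun y => y `^ alpha)).
    by rewrite qE; exact: continuous_horner.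
  by apply: differentiable_continuous; apply/derivable1_diffP; case: (is_derive1_powR alpha x0).
- have cFphi : {within `[(-1), 1], continuous (fun x : R => c * phi (1 - x ^+ 2) * q.[x])}; last first.
    move: cFphi; apply: subspace_eq_continuous => /=.
    move=> x; rewrite inE /= in_itv /= => /andP[x1 x2].
    by rewrite /from_subspace /= /F phiE //; nra.
  apply: continuous_subspaceT => x; apply: (@continuousM _ _ (fun y : R => c * phi (1 - y ^+ 2)) (horner q)); last exact: continuous_horner.
  apply: (@continuousM _ _ (cst c) (fun y : R => phi (1 - y ^+ 2))); first exact: cst_continuous.
  apply: (@continuous_comp _ _ _ (fun x : R => 1 - x ^+ 2) phi); last exact: cphi.
  by rewrite qE; exact: continuous_horner.
- move=> x; rewrite in_itv /= => /andP[x1 x2].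
  have x0 : 0 < 1 - x ^+ 2 by nra.
  have d1 : is_derive x 1 (fun x : R => 1 - x ^+ 2) (- (2 * x)).
    rewrite qE; apply: is_derive_eq (is_derive_horner _ _) _.
    by rewrite derivB derivC derivXn !hornerE /=; ring.
  have d2 := @is_derive1_comp R (fun y : R => y `^ (alpha + 1)) (fun y : R => 1 - y ^+ 2) x _ _ (is_derive1_powR (alpha + 1) x0) d1.
  have d3 := is_deriveM (is_deriveM (is_derive_cst c x 1) d2) (is_derive_horner q x).
  apply: is_derive_eq d3 _.
  rewrite [(cst c * _) x](_ : _ = c * (1 - x ^+ 2) `^ (alpha + 1)) // /f /r addrK /= powRD; last by rewrite (gt_eqF x0) implybT.
  rewrite powRr1 ?ltW // !hornerE /= /GRing.scale /=; ring.
Qed.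

End orthonormal_polynomials.

Lemma hornerB (R : nzRingType) (p q : {poly R}) x : (p - q).[x] = p.[x] - q.[x].
Proof. by rewrite hornerD hornerN. Qed.

Section gegenbauer_operator.
Context {R : realType} (alpha : R).

(** The ultraspherical operator (1 - x^2)^(-alpha) ((1 - x^2)^(alpha + 1) p')', expanded. *)
Definition gegenbauer_op (p : {poly R}) : {poly R} :=
  (1 - 'X^2) * p^`()^`() - (2 * (alpha + 1)) *: ('X * p^`()).

Lemma coef_gegenbauer_op (p : {poly R}) i :
  (gegenbauer_op p)`_i = (i.+2 * i.+1)%:R * p`_i.+2 -
    i%:R * (i%:R + 2 * alpha + 1) * p`_i.
Proof.
rewrite /gegenbauer_op mulrBl mul1r !coefB coefZ coefXM coefXnM !coef_deriv.
case: i => [|[|i]] /=.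
- by ring.
- by ring.
- by rewrite !subSS subn0; ring.
Qed.

Lemma size_gegenbauer_op (p : {poly R}) : (size (gegenbauer_op p) <= size p)%N.
Proof.
apply/leq_sizeP => i hi; rewrite coef_gegenbauer_op !nth_default ?mulr0 ?subr0 //.
exact: (leq_trans hi (leq_trans (leqnSn _) (leqnSn _))).
Qed.

Variable P : nat -> {poly R}.
Hypothesis HP : is_orthonormal_polys alpha P.
Variable phi : R -> R.
Hypothesis cphi : continuous phi.
Hypothesis phiE : forall y : R, 0 <= y -> phi y = y `^ (alpha + 1).
Hypothesis alpha1 : alpha + 1 != 0.

Notation mu := (gegenbauer_measure alpha).
Notation L p := (\int[mu]_x (p : {poly R}).[x]).

Let sP n : size (P n) = n.+1. Proof. by case: HP. Qed.

Let divergence (q : {poly R}) :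
  L ((1 - 'X^2) * q^`() - (2 * (alpha + 1)) *: ('X * q)) = 0.
Proof. exact: (gint_divergence HP q cphi phiE alpha1). Qed.

(** Lagrange's identity: the integrands differ by the divergence expression of the Wronskian p' q -
    p q', whose integral is zero. *)
Lemma gint_op_sym (p q : {poly R}) :
  L (gegenbauer_op p * q) = L (p * gegenbauer_op q).
Proof.
apply/eqP; rewrite -subr_eq0 -(gintB HP) -[X in _ == X](divergence (p^`() * q - p * q^`())).
apply/eqP; apply: eq_Rintegral => x _; congr (_.[x]).
by rewrite /gegenbauer_op derivB !derivM -!mul_polyC; ring.
Qed.

Lemma gint_op_energy (p : {poly R}) :
  L ((1 - 'X^2) * p^`() ^+ 2) = - L (p * gegenbauer_op p).
Proof.
apply/eqP; rewrite -subr_eq0 opprK -(gintD HP) -[X in _ == X](divergence (p * p^`())).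
apply/eqP; apply: eq_Rintegral => x _; congr (_.[x]).
by rewrite /gegenbauer_op derivM -!mul_polyC; ring.
Qed.

Let ev n : R := n%:R * (n%:R + 2 * alpha + 1).

(** The coefficients of X^n cancel, so the remainder [E] is a combination of the P_k with k < n. Its
    k-th coefficient is the integral of E P_k, which vanishes because the operator can be moved to
    P_k and does not raise its degree. *)
Lemma orthonormal_ode n : gegenbauer_op (P n) = - (ev n *: P n).
Proof.
apply/eqP; rewrite -subr_eq0 opprK; set E := _ + _.
have sE : (size E <= n)%N.
  apply/leq_sizeP => i; rewrite /E coefD coefZ coef_gegenbauer_op.
  rewrite leq_eqVlt => /predU1P[<-|ni].
    by rewrite nth_default ?sP // mulr0 sub0r addNr.
  rewrite !nth_default ?sP ?mulr0 ?subr0 ?add0r ?mulr0 //.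
  by rewrite (leq_trans ni) // (leq_trans (leqnSn _)).
have [c cE] := poly_span_size sP sE.
rewrite cE; apply/eqP; apply: big1 => k _; suff -> : c k = 0 by rewrite scale0r.
have : L (E * P k) = 0.
  rewrite /E mulrDl (gintD HP) gint_op_sym -scalerAl (gintZ HP).
  rewrite !(gint_orth_lt HP) ?mulr0 ?addr0 ?sP //.
  by rewrite (leq_trans (size_gegenbauer_op _)) // sP.
rewrite cE mulr_suml (gint_sum HP) (bigD1 k) //= big1 => [|j jk].
  by rewrite addr0 -scalerAl (gintZ HP) (gint_orth HP) eqxx mulr1.
have /negbTE jk' : (j : nat) != k := jk.
by rewrite -scalerAl (gintZ HP) (gint_orth HP) jk' mulr0.
Qed.

(** Each summand contributes [ev n]. The pointwise bounds compare this integral with the value of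
    the same expression at one point. *)
Lemma orthonormal_energy n :
  L (ev n *: P n ^+ 2 + (1 - 'X^2) * (P n)^`() ^+ 2) = 2 * ev n.
Proof.
rewrite (gintD HP) (gintZ HP) gint_op_energy orthonormal_ode mulrN -scalerAr.
rewrite (gintN HP) opprK (gintZ HP) expr2 (gint_orth HP) eqxx.
rewrite [true%:R]mulr1n; ring.
Qed.

End gegenbauer_operator.

Lemma orthonormal0_sqr (R : realType) (alpha : R) (P : nat -> {poly R}) (x : R) :
  is_orthonormal_polys alpha P ->
  (P 0%N).[x] ^+ 2 = (\int[gegenbauer_measure alpha]_x (1 : {poly R}).[x])^-1.
Proof.
move=> HP; have [a _ P0] : exists2 a, a != 0 & P 0 = a%:P.
  have /eqP/size_poly1P[a a0 ->] : size (P 0) = 1%N by case: HP.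
  by exists a.
rewrite P0 hornerC -[RHS]mul1r; apply: canRL (mulfK (lt0r_neq0 (gint1_gt0 HP))) _.
by rewrite -(gintZ HP) -[RHS](gint_orth HP 0 0) P0 -polyCM -mul_polyC mulr1.
Qed.

(** The sign of c x records that c lies on the same side of 0 as x; this yields monotonicity away
    from 0 in both directions at once. *)
Lemma MVT_from0 (R : realType) (f df : R -> R) (x : R) : x != 0 ->
  (forall t : R, `|t| <= `|x| -> is_derive t 1 f (df t)) ->
  exists c, [/\ `|c| <= `|x|, 0 <= c * x & f x - f 0 = df c * x].
Proof.
move=> x0 fdf; have [xp|xn|/eqP] := ltrgtP 0 x; last by rewrite eq_sym (negbTE x0).
  have tx t : t \in `[0, x] -> `|t| <= `|x|.
    by rewrite in_itv /= => /andP[t0 tx]; rewrite !ger0_norm // ltW.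
  have [||c cx ->] := @MVT _ f df 0 x xp.
  - by move=> t /subset_itv_oo_cc/tx/fdf.
  - by apply: derivable_within_continuous => t /tx/fdf[].
  move/subset_itv_oo_cc: (cx) => /tx cx'; exists c; split => //; last by rewrite subr0.
  by move: cx; rewrite in_itv /= => /andP[c0 _]; rewrite mulr_ge0 // ltW.
have tx t : t \in `[x, 0] -> `|t| <= `|x|.
  by rewrite in_itv /= => /andP[tx t0]; rewrite !ler0_norm ?lerN2 // ltW.
have [||c cx h] := @MVT _ f df x 0 xn.
- by move=> t /subset_itv_oo_cc/tx/fdf.
- by apply: derivable_within_continuous => t /tx/fdf[].
move/subset_itv_oo_cc: (cx) => /tx cx'; exists c; split => //.
  by move: cx; rewrite in_itv /= => /andP[_ c0]; rewrite mulr_le0 // ltW.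
by rewrite -opprB h sub0r mulrN opprK.
Qed.

(** * Pointwise bounds for the weighted polynomials *)

Section bounds.
Context {R : realType} (P : nat -> {poly R}).

Section chebyshev.
Hypothesis HP : is_orthonormal_polys (- 2^-1) P.
Notation mu := (gegenbauer_measure (- 2^-1)).
Notation L p := (\int[mu]_x (p : {poly R}).[x]).

(** A constant function equals its mean, and the energy identity puts that mean at 2 k / L 1. *)
Lemma chebyshev_bound n (x : R) : `|x| <= 1 -> (P n).[x] ^+ 2 <= 2 / L 1.
Proof.
have lam0 := gint1_gt0 HP.
have powE (y : R) : 0 <= y -> Num.sqrt y = y `^ (- 2^-1 + 1).
  by move=> y0; rewrite -powR12_sqrt //; congr (_ `^ _); lra.
have alpha1 : - 2^-1 + 1 != 0 :> R by apply/eqP; lra.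
have ode := orthonormal_ode HP (@sqrt_continuous R) powE alpha1.
have energy := orthonormal_energy HP (@sqrt_continuous R) powE alpha1.
move=> x1; have x2 : 0 <= 1 - x ^+ 2.
  by rewrite subr_ge0 -real_normK ?num_real // expr_le1.
have [->|n0] := posnP n.
  by rewrite (orthonormal0_sqr x HP) ler_peMl ?invr_ge0 ?(ltW lam0) ?ler1n.
pose k : R := n%:R * (n%:R + 2 * (- 2^-1) + 1).
have k0 : 0 < k.
  have n1 : 1 <= n%:R :> R by rewrite ler1n.
  by rewrite /k mulr_gt0 //; lra.
(* This is k (cos^2 + sin^2): the differential equation makes it constant. *)
pose Q := k *: P n ^+ 2 + (1 - 'X^2) * (P n)^`() ^+ 2.
have dQ : Q^`() = 0.
  have : 2 * (P n)^`() * (k *: P n + gegenbauer_op (- 2^-1) (P n)) = 0.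
    by rewrite ode addrN mulr0.
  move=> <-; rewrite /Q /gegenbauer_op derivD derivZ [P n ^+ 2]expr2 [_^`() ^+ 2]expr2 !derivM derivB derivC derivXn.
  rewrite -!mul_polyC /=.
  have -> : (2 * (- 2^-1 + 1))%:P = 1 :> {poly R} by rewrite -polyC1; congr (_%:P); lra.
  by rewrite expr1; ring.
have Qc t : Q.[t] = Q.[0].
  have [->//|t0] := eqVneq t 0.
  have [c [_ _ h]] := MVT_from0 t0 (fun u _ => is_derive_horner Q u).
  by apply/eqP; rewrite -subr_eq0 h dQ horner0 mul0r.
have : L Q = 2 * k by exact: energy.
have -> : L Q = Q.[0] * L 1.
  by rewrite -(gintZ HP); apply: eq_Rintegral => t _; rewrite Qc hornerZ hornerC mulr1.
rewrite -(Qc x) => h.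
have h2 : k * (P n).[x] ^+ 2 * L 1 <= 2 * k.
  rewrite -h ler_wpM2r ?(ltW lam0) // /Q hornerD hornerZ !hornerM -!expr2.
  by rewrite hornerD hornerN hornerC hornerXn lerDl mulr_ge0 ?sqr_ge0.
by rewrite ler_pdivlMr // -(ler_pM2l k0) mulrA (le_trans h2) // mulrC.
Qed.

End chebyshev.

Section legendre.
Hypothesis HP : is_orthonormal_polys 0 P.
Notation mu := (gegenbauer_measure 0).
Notation L p := (\int[mu]_x (p : {poly R}).[x]).

(** [E] has derivative 2 x P_n'^2, hence its minimum at 0, and its integral is 2 k: this bounds P_n
    and P_n' at the single point 0. A second monotone quantity, [W], carries the bound from 0 to
    x. *)
Lemma legendre_bound n (x : R) : `|x| <= 1 ->
  Num.sqrt (1 - x ^+ 2) * (P n).[x] ^+ 2 <= 2 / L 1.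
Proof.
have lam0 := gint1_gt0 HP.
have powE (y : R) : 0 <= y -> y = y `^ (0 + 1).
  by move=> y0; rewrite add0r powRr1.
have alpha1 : 0 + 1 != 0 :> R by rewrite add0r oner_eq0.
have idc : continuous (@id R) by move=> ?.
have ode := orthonormal_ode HP idc powE alpha1.
have energy := orthonormal_energy HP idc powE alpha1.
move=> x1; have x2 : 0 <= 1 - x ^+ 2.
  by rewrite subr_ge0 -real_normK ?num_real // expr_le1.
have [->|n0] := posnP n.
  rewrite (orthonormal0_sqr x HP) ler_wpM2r ?invr_ge0 ?(ltW lam0) //.
  rewrite (@le_trans _ _ 1) ?ler1n // -[leRHS]sqrtr1 ler_wsqrtr //.
  by rewrite gerBl sqr_ge0.
pose k : R := n%:R * (n%:R + 2 * 0 + 1).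
have k0 : 0 < k.
  have n1 : 1 <= n%:R :> R by rewrite ler1n.
  by rewrite /k mulr_gt0 //; lra.
pose y t := (P n).[t]; pose y1 t := (P n)^`().[t].
have odeP : (1 - 'X^2) * (P n)^`()^`() = 2 *: ('X * (P n)^`()) - k *: P n.
  have := ode n; rewrite /gegenbauer_op -/k add0r mulr1 => h.
  by rewrite -[LHS](subrK (2 *: ('X * (P n)^`()))) h [RHS]addrC.
pose E := k *: P n ^+ 2 + (1 - 'X^2) * (P n)^`() ^+ 2.
have dE : E^`() = 2 *: ('X * (P n)^`() ^+ 2).
  rewrite /E derivD derivZ [P n ^+ 2]expr2 [_^`() ^+ 2]expr2 !derivM derivB derivC derivXn.
  rewrite (_ : _ + _ = 2 *: (P n)^`() * (k *: P n + (1 - 'X^2) * (P n)^`()^`())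
     - 2 *: ('X * (P n)^`() ^+ 2)); last by rewrite -!mul_polyC /= expr1; ring.
  by rewrite odeP -!mul_polyC; ring.
have E0 t : E.[0] <= E.[t].
  have [->//|t0] := eqVneq t 0.
  have [c [_ ct h]] := MVT_from0 t0 (fun u _ => is_derive_horner E u).
  rewrite -subr_ge0 h dE hornerZ !hornerM hornerX.
  rewrite (_ : _ * t = 2 * (y1 c ^+ 2 * (c * t))); last by rewrite /y1; ring.
  by apply: mulr_ge0 => //; apply: mulr_ge0 => //; exact: sqr_ge0.
have E0le : E.[0] * L 1 <= 2 * k.
  rewrite -(energy n) -/k -/E -(gintZ HP); apply: le_Rintegral => //.
  - exact: (poly_integrable HP).
  - exact: (poly_integrable HP).
  - by move=> t _; rewrite hornerZ hornerC mulr1 E0.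
(* With x = cos theta, the function u = (sin theta)^(1/2) P_n satisfies u'' + phi u = 0 for phi = D
   / (4 sin^2 theta), and z = -2 (sin theta)^(1/2) u'. So [W] is the square of Sonin's function u^2
   + u'^2 / phi; squaring removes the root of 1 - x^2. *)
pose z := 2 *: ((1 - 'X^2) * (P n)^`()) - 'X * P n.
have dz : z^`() = - ((2 * k + 1) *: P n) - 'X * (P n)^`().
  rewrite /z derivB derivZ !derivM derivB derivC derivXn derivX.
  rewrite (_ : _ - _ = 2 *: ((1 - 'X^2) * (P n)^`()^`()) - 4 *: ('X * (P n)^`())
    - P n - 'X * (P n)^`()); last by rewrite -!mul_polyC /= expr1; ring.
  by rewrite odeP -!mul_polyC; ring.
pose D : {poly R} := (4 * k + 1) *: (1 - 'X^2) + 1.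
(* Sonin-type function: W increases up to 0 and decreases afterwards, and
   W(0) <= (E(0) / k)^2 while W(x) dominates (1 - x^2) y^4. *)
pose W t := (1 - 'X^2).[t] * (y t ^+ 2 + z.[t] ^+ 2 * (D.[t])^-1) ^+ 2.
have DE t : D.[t] = (4 * k + 1) * (1 - t ^+ 2) + 1 by rewrite /D !hornerE.
have D1 t : `|t| <= `|x| -> 1 <= D.[t].
  move=> tx; rewrite DE lerDr mulr_ge0 //; first by lra.
  by rewrite subr_ge0 -real_normK ?num_real // expr_le1 // (le_trans tx).
have dW (t : R) : `|t| <= `|x| -> is_derive t 1 W
   (- (4 * t * (y t ^+ 2 + z.[t] ^+ 2 / D.[t]) * (z.[t] ^+ 2 / D.[t] ^+ 2))).
  move=> /D1 Dt.
  have D0 : D.[t] != 0 by rewrite gt_eqF // (lt_le_trans ltr01).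
  have dDV : is_derive t 1 (fun u => (D.[u])^-1) (2 * (4 * k + 1) * t / D.[t] ^+ 2).
    apply: DeriveDef; first exact/derivableV/derivable_horner.
    rewrite deriveV ?derivable_horner //.
    have [_ ->] := is_derive_horner D t.
    rewrite /D derivD derivZ derivB derivC derivXn hornerD hornerZ hornerB !hornerC.
    by rewrite hornerMn hornerXn /GRing.scale /=; ring.
  have dA : is_derive t 1 (horner (1 - 'X^2)) (- (2 * t)).
    apply: is_derive_eq (is_derive_horner _ _) _.
    by rewrite derivB derivC derivXn hornerB hornerC hornerMn hornerXn; ring.
  have dy2 : is_derive t 1 (horner (P n ^+ 2)) (2 * y t * y1 t).
    apply: is_derive_eq (is_derive_horner _ _) _.
    by rewrite expr2 derivM hornerD !hornerM /y /y1; ring.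
  have dz2 : is_derive t 1 (horner (z ^+ 2)) (2 * z.[t] * (- ((2 * k + 1) * y t) - t * y1 t)).
    apply: is_derive_eq (is_derive_horner _ _) _.
    rewrite expr2 derivM dz hornerD !hornerM hornerB hornerN hornerZ hornerM hornerX.
    by rewrite /y /y1; ring.
  have dd := is_deriveM dA (is_deriveX 2 (is_deriveD dy2 (is_deriveM dz2 dDV))).
  rewrite (_ : W = horner (1 - 'X^2) * (horner (P n ^+ 2) +
      horner (z ^+ 2) * (fun u => (D.[u])^-1)) ^+ 2); last first.
    by apply/funext => u; rewrite /W /y !fctE !horner_exp.
  apply: is_derive_eq dd _.
  have zE : z.[t] = 2 * ((1 - t ^+ 2) * y1 t) - t * y t.
    by rewrite /z hornerB hornerZ !hornerM hornerB hornerC hornerXn hornerX.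
  have aE : (1 - 'X^2).[t] = 1 - t ^+ 2 by rewrite hornerB hornerC hornerXn.
  rewrite !fctE /GRing.scale /= aE !horner_exp -/(y t).
  move: D0; rewrite zE DE => D0.
  field.
  exact: D0.
have Wle : W x <= W 0.
  have [->//|x0] := eqVneq x 0.
  have [c [cx ct h]] := MVT_from0 x0 dW.
  rewrite -subr_le0 h.
  rewrite (_ : _ * x = - (4 * ((c * x) * ((y c ^+ 2 + z.[c] ^+ 2 / D.[c]) *
     (z.[c] ^+ 2 / D.[c] ^+ 2))))); last by ring.
  have Dc : 0 <= D.[c] by rewrite (le_trans _ (D1 c cx)).
  rewrite oppr_le0 mulr_ge0 // mulr_ge0 // mulr_ge0 //.
    by rewrite addr_ge0 ?sqr_ge0 // divr_ge0 ?sqr_ge0.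
  by rewrite divr_ge0 ?sqr_ge0.
have lamV : 0 <= 2 / L 1 by rewrite divr_ge0 // ltW.
(* At 0, z = 2 P_n' and D = 4 k + 2, so z^2 / D <= P_n'^2 / k and the bracket is at most E(0) /
   k. *)
have W0 : W 0 <= (2 / L 1) ^+ 2.
  rewrite /W hornerB hornerC hornerXn expr0n subr0 mul1r DE expr0n subr0 mulr1.
  have z0 : z.[0] = 2 * y1 0.
    by rewrite /z hornerB hornerZ !hornerM hornerB hornerC hornerXn hornerX /y1; ring.
  have D00 : 0 < 4 * k + 1 + 1 by lra.
  rewrite lerXn2r ?nnegrE //.
    by rewrite addr_ge0 ?sqr_ge0 // divr_ge0 ?sqr_ge0 // ltW.
  apply: (@le_trans _ _ (E.[0] / k)).
    rewrite z0 /E hornerD hornerZ !hornerM hornerB hornerC hornerXn expr0n subr0 mul1r.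
    rewrite -!expr2 -/(y 0) -/(y1 0) [leRHS](_ : _ = y 0 ^+ 2 + y1 0 ^+ 2 / k); last first.
      by field; rewrite gt_eqF.
    rewrite lerD2l.
    rewrite exprMn ler_pdivrMr // [leRHS]mulrAC ler_pdivlMr //.
    have := sqr_ge0 (y1 0); nra.
  by rewrite ler_pdivrMr // [leRHS]mulrAC ler_pdivlMr.
have : (Num.sqrt (1 - x ^+ 2) * (P n).[x] ^+ 2) ^+ 2 <= (2 / L 1) ^+ 2.
  apply: (le_trans _ (le_trans Wle W0)).
  rewrite exprMn sqr_sqrtr // /W hornerB hornerC hornerXn ler_wpM2l //.
  rewrite lerXn2r ?nnegrE ?addr_ge0 ?sqr_ge0 // ?divr_ge0 ?sqr_ge0 ?(le_trans _ (D1 x _)) //.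
  by rewrite lerDl divr_ge0 ?sqr_ge0 // (le_trans _ (D1 x _)).
by rewrite ler_pXn2r ?nnegrE // mulr_ge0 ?sqr_ge0 ?sqrtr_ge0.
Qed.

End legendre.
End bounds.

Lemma orthonormal_bound (R : realType) (alpha : R) (P : nat -> {poly R}) n (x : R) :
  alpha = 0 \/ alpha = - 2^-1 -> is_orthonormal_polys alpha P -> `|x| <= 1 ->
  (1 - x ^+ 2) `^ (alpha + 2^-1) * (P n).[x] ^+ 2
  <= 2 / \int[gegenbauer_measure alpha]_x (1 : {poly R}).[x].
Proof.
move=> ha HP x1; have x2 : 0 <= 1 - x ^+ 2.
  by rewrite subr_ge0 -real_normK ?num_real // expr_le1.
case: ha HP => -> HP; first by rewrite add0r powR12_sqrt //; exact: legendre_bound.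
by rewrite addNr powRr0 mul1r; exact: chebyshev_bound.
Qed.

(** * Discretisation of the measure on a uniform grid *)

Lemma poly_bounded_lipschitz (R : realType) (p : {poly R}) :
  exists2 C, 0 <= C & forall x y : R, `|x| <= 1 -> `|y| <= 1 ->
    `|p.[x]| <= C /\ `|p.[x] - p.[y]| <= C * `|x - y|.
Proof.
elim/poly_ind: p => [|p c [C C0 hC]].
  by exists 0 => // x y _ _; rewrite !horner0 subrr normr0 mul0r.
exists (2 * C + `|c|); first by rewrite addr_ge0 // mulr_ge0.
move=> x y x1 y1; rewrite !hornerMXaddC.
have [[px pxy] [py _]] := (hC _ _ x1 y1, hC _ _ y1 x1); split.
  rewrite (le_trans (ler_normD _ _)) // lerD2r normrM.
  by rewrite (le_trans (ler_pM _ _ px x1)) //; lra.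
rewrite (_ : _ - _ = (p.[x] - p.[y]) * x + p.[y] * (x - y)); last by ring.
rewrite (le_trans (ler_normD _ _)) // !normrM.
have h1 : `|p.[x] - p.[y]| * `|x| <= C * `|x - y|.
  by rewrite -[leRHS]mulr1 ler_pM.
have h2 : `|p.[y]| * `|x - y| <= C * `|x - y| by rewrite ler_wpM2r.
have h3 : 0 <= `|c| * `|x - y| by rewrite mulr_ge0.
by lra.
Qed.

(** Expanding the square into the products P_k P_l gives a constant independent of [b], so that one
    grid serves all coefficient sequences. *)
Lemma sqr_comb_lipschitz (R : realType) (P : nat -> {poly R}) N :
  exists2 C, 0 <= C & forall (b : nat -> R) (x y : R), `|x| <= 1 -> `|y| <= 1 ->
    `|(\sum_(k < N) b k * (P k).[x]) ^+ 2 - (\sum_(k < N) b k * (P k).[y]) ^+ 2|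
    <= C * `|x - y| * (\sum_(k < N) `|b k|) ^+ 2.
Proof.
pose C k l := sval (cid2 (poly_bounded_lipschitz (P k * P l))).
have C0 k l : 0 <= C k l by rewrite /C; case: cid2.
have CP k l x y : `|x| <= 1 -> `|y| <= 1 ->
    `|(P k).[x] * (P l).[x] - (P k).[y] * (P l).[y]| <= C k l * `|x - y|.
  by move=> x1 y1; rewrite /C; case: cid2 => c /= _ /(_ x y x1 y1)[_]; rewrite !hornerM.
pose S := \sum_(k < N) \sum_(l < N) C k l.
have CS (k l : 'I_N) : C k l <= S.
  rewrite /S (bigD1 k) //= (bigD1 l) //= -addrA lerDl addr_ge0 //.
    exact: sumr_ge0.
  by apply: sumr_ge0 => i _; exact: sumr_ge0.
have S0 : 0 <= S by apply: sumr_ge0 => i _; exact: sumr_ge0.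
clearbody S; exists S => // b x y x1 y1.
have sqE z : (\sum_(k < N) b k * (P k).[z]) ^+ 2 =
    \sum_(k < N) \sum_(l < N) b k * b l * ((P k).[z] * (P l).[z]).
  rewrite expr2 mulr_suml; apply: eq_bigr => k _.
  by rewrite mulr_sumr; apply: eq_bigr => l _; ring.
rewrite !sqE -sumrB (le_trans (ler_norm_sum _ _ _)) //.
rewrite expr2 mulr_suml mulr_sumr; apply: ler_sum => k _.
rewrite -sumrB (le_trans (ler_norm_sum _ _ _)) //.
rewrite !mulr_sumr; apply: ler_sum => l _.
rewrite -mulrBr !normrM mulrC ler_wpM2r ?mulr_ge0 //.
by rewrite (le_trans (CP _ _ _ _ x1 y1)) // ler_wpM2r.
Qed.

Section quadrature.
Context {R : realType} (alpha : R) (P : nat -> {poly R}).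
Hypothesis HP : is_orthonormal_polys alpha P.
Notation mu := (gegenbauer_measure alpha).
Notation L p := (\int[mu]_x (p : {poly R}).[x]).

Lemma gint_sqr_comb N (b : nat -> R) :
  L ((\sum_(k < N) b k *: P k) ^+ 2) = \sum_(k < N) b k ^+ 2.
Proof.
rewrite expr2 mulr_suml (gint_sum HP); apply: eq_bigr => k _.
rewrite mulr_sumr (gint_sum HP) (bigD1 k) //= big1 => [|l lk].
  by rewrite addr0 -scalerAl -scalerAr !(gintZ HP) (gint_orth HP) eqxx mulr1.
rewrite -scalerAl -scalerAr !(gintZ HP) (gint_orth HP).
have /negbTE -> : (k : nat) != l by rewrite eq_sym.
by rewrite !mulr0.
Qed.

Lemma gegenbauer_measure_fin : mu setT = (L 1)%:E.
Proof.
have := integrable_fin_num measurableT (poly_integrable HP 1).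
rewrite /Rintegral => /fineK ->.
by under eq_integral do rewrite hornerC; rewrite integral_cst // mul1e.
Qed.

Definition cell (M j : nat) : set R :=
  `[-1 + 2 * j%:R / M%:R, -1 + 2 * j.+1%:R / M%:R[.

(* The cell of index M only serves to cover the point 1; it is sampled at the
   node of the preceding cell. *)
Definition node (M j : nat) : R := -1 + (2 * (minn j M.-1)%:R + 1) / M%:R.

Lemma node_itv M j : (0 < M)%N -> -1 < node M j < 1.
Proof.
move=> M0; have MR : 0 < M%:R :> R by rewrite ltr0n.
rewrite /node ltrDl divr_gt0 ?ltr_wpDl ?mulr_ge0 //= addrC ltrBlDr ltr_pdivrMr //.
have : (minn j M.-1).+1%:R <= M%:R :> R by rewrite ler_nat -{2}(prednK M0) ltnS geq_minr.
by rewrite -natr1; lra.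
Qed.

Lemma cell_node M j (t : R) : (0 < M)%N -> (j <= M)%N -> `|t| <= 1 ->
  cell M j t -> `|t - node M j| <= M%:R^-1.
Proof.
move=> M0 jM; have MR : 0 < M%:R :> R by rewrite ltr0n.
rewrite /cell /= in_itv /= !ler_norml => /andP[t1 t2] /andP[h1 h2].
move: jM; rewrite leq_eqVlt => /predU1P[jM|jM].
  move: h1; rewrite jM mulfK ?gt_eqF // => h1.
  have -> : node M M = 1 - M%:R^-1.
    rewrite /node (minn_idPr _) ?leq_pred // -subn1 natrB //.
    by field; rewrite gt_eqF.
  have Mi : 0 < M%:R^-1 :> R by rewrite invr_gt0.
  by lra.
have -> : node M j = -1 + 2 * j%:R / M%:R + M%:R^-1.
  rewrite /node (minn_idPl _); last by rewrite -ltnS prednK.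
  by field; rewrite gt_eqF.
have e2 : 2 * j.+1%:R / M%:R = 2 * j%:R / M%:R + 2 * M%:R^-1 :> R.
  by rewrite -natr1; ring.
move: h1 h2; rewrite e2; lra.
Qed.

Lemma cell_cover M (t : R) : (0 < M)%N -> `|t| <= 1 ->
  exists2 j, (j < M.+1)%N & cell M j t.
Proof.
move=> M0; have MR : 0 < M%:R :> R by rewrite ltr0n.
rewrite ler_norml => /andP[t1 t2].
have u0 : 0 <= (t + 1) * M%:R / 2 by rewrite divr_ge0 // mulr_ge0 //; lra.
have /andP[h1 h2] := truncn_itv u0.
exists (Num.truncn ((t + 1) * M%:R / 2)).
  rewrite ltnS -(ler_nat R) (le_trans h1) //.
  have : (t + 1) * M%:R <= 2 * M%:R by rewrite ler_wpM2r //; lra.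
  lra.
set k := Num.truncn _ in h1 h2 *; rewrite /cell /= in_itv /=.
have h3 : 2 * k%:R / M%:R <= t + 1 by rewrite ler_pdivrMr //; lra.
have h4 : t + 1 < 2 * k.+1%:R / M%:R by rewrite ltr_pdivlMr //; lra.
by apply/andP; split; [lra|move: h4; set y := 2 * _ / _; lra].
Qed.

Lemma cell_disjoint M i j (t : R) : (0 < M)%N -> cell M i t -> cell M j t -> i = j.
Proof.
move=> M0; have MR : 0 < M%:R :> R by rewrite ltr0n.
rewrite /cell /= !in_itv /= => /andP[i1 i2] /andP[j1 j2].
have aux a b : -1 + 2 * a%:R / M%:R <= t -> t < -1 + 2 * b.+1%:R / M%:R -> (a <= b)%N.
  move=> h1 h2; rewrite -ltnS -(ltr_nat R).
  have : 2 * a%:R / M%:R < 2 * b.+1%:R / M%:R :> R by lra.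
  by rewrite ltr_pM2r ?invr_gt0 // ltr_pM2l.
by apply/eqP; rewrite eqn_leq !aux.
Qed.

Definition cell_mass (M j : nat) : R := fine (mu (cell M j)).

Lemma measurable_cell M j : measurable (cell M j : set (measurableTypeR R)).
Proof. exact: measurable_itv. Qed.

Lemma cell_massE M j : mu (cell M j) = (cell_mass M j)%:E.
Proof.
rewrite /cell_mass fineK // ge0_fin_numE //.
have muT : (mu setT < +oo)%E by rewrite gegenbauer_measure_fin ltry.
apply: le_lt_trans muT; apply: (@le_measure _ _ _ mu); rewrite ?inE //.
exact: measurable_cell.
Qed.

Lemma cell_mass_ge0 M j : 0 <= cell_mass M j.
Proof. by rewrite fine_ge0. Qed.

Lemma sum_cell_indic_le1 M (t : R) : (0 < M)%N ->
  \sum_(j < M.+1) \1_(cell M j) t <= 1 :> R.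
Proof.
move=> M0; have [[j tj]|no] := pselect (exists j : 'I_M.+1, cell M j t).
  rewrite (bigD1 j) //= big1 ?addr0 => [|i ij]; first by rewrite indicE lern1 leq_b1.
  rewrite indicE memNset // => ti; move/eqP: ij; apply.
  exact/val_inj/(cell_disjoint M0 ti tj).
rewrite big1 // => j _; rewrite indicE memNset // => tj.
by apply: no; exists j.
Qed.

Lemma integral_cells M (v : nat -> R) : (forall j, 0 <= v j) ->
  (\int[mu]_t (\sum_(j < M.+1) v j * \1_(cell M j) t)%:E =
   (\sum_(j < M.+1) v j * cell_mass M j)%:E)%E.
Proof.
move=> v0; under eq_integral do rewrite -sumEFin.
rewrite ge0_integral_sum //.
- rewrite -sumEFin; apply: eq_bigr => j _.
  under eq_integral do rewrite EFinM.
  rewrite ge0_integralZl_EFin //.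
  + rewrite integral_indic ?setIT //; last exact: (measurable_cell M j).
    by rewrite EFinM; congr (_ * _)%E; exact: cell_massE.
  + by apply/measurable_EFinP; apply: measurable_indic; exact: (measurable_cell M j).
- move=> j; apply/measurable_EFinP; apply: measurable_funM => //.
  by apply: measurable_indic; exact: (measurable_cell M j).
- by move=> j t _; rewrite lee_fin mulr_ge0.
Qed.

Lemma sum_cell_mass_le M : (0 < M)%N -> \sum_(j < M.+1) cell_mass M j <= L 1.
Proof.
move=> M0; rewrite -lee_fin -gegenbauer_measure_fin.
have := @integral_cells M (fun=> 1) (fun=> ler01).
under eq_bigr do rewrite mul1r; move=> <-.
rewrite -[leRHS]mul1e -integral_cst //; apply: ge0_le_integral => //.
- by move=> t _; rewrite lee_fin sumr_ge0 // => j _; rewrite mul1r.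
- apply/measurable_EFinP; apply: measurable_sum => j; apply: measurable_funM => //.
  by apply: measurable_indic; exact: (measurable_cell M j).
- move=> t _; rewrite lee_fin; under eq_bigr do rewrite mul1r.
  exact: sum_cell_indic_le1.
Qed.

End quadrature.

(** Telescoping: 1 / b <= 2 (b - a) for b = sqrt(M + 1) and a = sqrt M, from b^2 - a^2 = 1 and (b -
    a)^2 >= 0. *)
Lemma sum_invsqrt_le (R : realType) M :
  \sum_(j < M) (Num.sqrt (j.+1%:R : R))^-1 <= 2 * Num.sqrt M%:R.
Proof.
elim: M => [|M IH]; first by rewrite big_ord0 mulr_ge0 ?sqrtr_ge0.
rewrite big_ord_recr /=; apply: (le_trans (lerD IH (lexx _))).
set a := Num.sqrt M%:R; set b := Num.sqrt M.+1%:R.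
have b0 : 0 < b by rewrite sqrtr_gt0 ltr0n.
have a0 : 0 <= a by exact: sqrtr_ge0.
have ab : b ^+ 2 = a ^+ 2 + 1 by rewrite !sqr_sqrtr ?ler0n // -natr1.
rewrite -lerBrDl -[leLHS]mul1r ler_pdivrMr //.
have : 0 <= (b - a) ^+ 2 by exact: sqr_ge0.
by lra.
Qed.

(** For x >= 0 already 1 - x^2 >= 1 - x, and symmetrically for x < 0; the singularities at the two
    end points can then be summed separately. *)
Lemma invsqrt_1Bsqr_le (R : realType) (x : R) : -1 < x < 1 ->
  (Num.sqrt (1 - x ^+ 2))^-1 <= (Num.sqrt (1 + x))^-1 + (Num.sqrt (1 - x))^-1.
Proof.
move=> /andP[x1 x2]; have [x0|x0] := leP 0 x.
  apply: (@le_trans _ _ (Num.sqrt (1 - x))^-1); last first.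
    by rewrite lerDr invr_ge0 sqrtr_ge0.
  rewrite lef_pV2 ?posrE ?sqrtr_gt0; try nra.
  by rewrite ler_wsqrtr //; nra.
apply: (@le_trans _ _ (Num.sqrt (1 + x))^-1); last first.
  by rewrite lerDl invr_ge0 sqrtr_ge0.
rewrite lef_pV2 ?posrE ?sqrtr_gt0; try nra.
by rewrite ler_wsqrtr //; nra.
Qed.

Section quadrature.
Context {R : realType} (alpha : R) (P : nat -> {poly R}).
Hypothesis HP : is_orthonormal_polys alpha P.
Notation mu := (gegenbauer_measure alpha).
Notation L p := (\int[mu]_x (p : {poly R}).[x]).

(** On a cell h^2 exceeds its value at the node by at most (C / M) |b|_1^2, and integration costs
    the total mass once more. M is fixed from C, [eps] and the mass, before [b]. *)
Lemma quadrature_lower N (eps : R) : 0 < eps ->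
  exists2 M : nat, (0 < M)%N & forall b : nat -> R,
    \sum_(k < N) b k ^+ 2 <=
    \sum_(j < M.+1) cell_mass alpha M j * (\sum_(k < N) b k * (P k).[node M j]) ^+ 2
    + eps * (\sum_(k < N) `|b k|) ^+ 2.
Proof.
move=> e0; have [C C0 hC] := sqr_comb_lipschitz P N.
have L1 := gint1_gt0 HP.
pose M := (Num.truncn (C * L 1 / eps)).+1.
have M0 : 0 < M%:R :> R by rewrite ltr0n.
have hM : C * M%:R^-1 * L 1 <= eps.
  rewrite mulrAC ler_pdivrMr // [leRHS]mulrC -ler_pdivrMr //.
  have tr0 : 0 <= C * L 1 / eps by rewrite divr_ge0 ?mulr_ge0 // ltW.
  by have /andP[_ /ltW] := truncn_itv tr0.
exists M => // b.
set B := (\sum_(k < N) `|b k|) ^+ 2; have B0 : 0 <= B by exact: sqr_ge0.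
pose h t := \sum_(k < N) b k * (P k).[t].
pose p := \sum_(k < N) b k *: P k.
have ph t : p.[t] = h t.
  by rewrite /p horner_sum; apply: eq_bigr => k _; rewrite hornerZ.
pose v j := h (node M j) ^+ 2 + C * M%:R^-1 * B.
have v0 j : 0 <= v j by rewrite addr_ge0 ?sqr_ge0 // mulr_ge0 // mulr_ge0 // invr_ge0 ltW.
have fE : (\int[mu]_t ((h t) ^+ 2)%:E)%E = (\sum_(k < N) b k ^+ 2)%:E.
  rewrite -(gint_sqr_comb HP) -/p /Rintegral fineK; last first.
    exact: (integrable_fin_num measurableT (poly_integrable HP _)).
  by apply: eq_integral => t _; rewrite expr2 hornerM !ph -expr2.
have mh : measurable_fun setT (fun t : measurableTypeR R => ((h t) ^+ 2)%:E).
  apply/measurable_EFinP; rewrite (_ : (fun _ => _) = horner (p ^+ 2)); last first.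
    by apply/funext => t; rewrite expr2 hornerM ph -expr2.
  exact: measurable_horner.
have mg : measurable_fun setT (fun t : measurableTypeR R =>
    (\sum_(j < M.+1) v j * \1_(cell M j) t)%:E).
  apply/measurable_EFinP; apply: measurable_sum => j; apply: measurable_funM => //.
  by apply: measurable_indic; exact: (measurable_cell M j).
have le1 : (\int[mu]_t ((h t) ^+ 2)%:E <=
    \int[mu]_t (\sum_(j < M.+1) v j * \1_(cell M j) t)%:E)%E.
  (* Writing out the density confines the comparison to [-1, 1], where the cells and the Lipschitz
     bound apply. *)
  rewrite !(@ge0_integral_density _ (measurableTypeR R) R lebesgue_measure mu _
    (gegenbauer_density_ge0 alpha) (measurable_gegenbauer_density alpha)
    (fun _ _ => erefl)) //; last 2 first.
  - by move=> t; rewrite lee_fin sumr_ge0 // => j _; rewrite mulr_ge0.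
  - by move=> t; rewrite lee_fin sqr_ge0.
  apply: ge0_le_integral => //.
  - by move=> t _; rewrite mule_ge0 ?lee_fin ?sqr_ge0 ?gegenbauer_density_ge0.
  - apply: emeasurable_funM => //; apply/measurable_EFinP.
    exact: measurable_gegenbauer_density.
  - apply: emeasurable_funM => //; apply/measurable_EFinP.
    exact: measurable_gegenbauer_density.
  move=> t _; rewrite -!EFinM lee_fin.
  have [t1|t1] := leP `|t| 1; last first.
    rewrite /gegenbauer_density indicE memNset ?mulr0 //= in_itv /= => /andP[h1 h2].
    by move: t1; rewrite ltNge ler_norml h1 h2.
  rewrite ler_wpM2r ?gegenbauer_density_ge0 //.
  have [j jM tj] := cell_cover (isT : (0 < M)%N) t1.
  rewrite (bigD1 (Ordinal jM)) //= indicE mem_set // mulr1.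
  rewrite -[leLHS]addr0 lerD ?sumr_ge0 // => [|i _]; last by rewrite mulr_ge0.
  have n1 : `|node M j : R| <= 1.
    have /andP[n1 n2] := @node_itv R M j isT.
    by rewrite ler_norml (ltW n1) (ltW n2).
  have := hC b t (node M j) t1 n1.
  rewrite ler_norml => /andP[_]; rewrite lerBlDl => hh.
  rewrite (le_trans hh) // /v lerD2l ler_wpM2r // ler_wpM2l //.
  exact: cell_node.
move: le1; rewrite fE (integral_cells HP) // lee_fin => /le_trans; apply.
rewrite (eq_bigr (fun j : 'I_M.+1 => cell_mass alpha M j * h (node M j) ^+ 2 +
   C * M%:R^-1 * B * cell_mass alpha M j)); last by move=> j _; rewrite /v; ring.
rewrite big_split /= lerD2l -mulr_sumr.
apply: (@le_trans _ _ (C * M%:R^-1 * B * L 1)).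
  rewrite ler_wpM2l ?(sum_cell_mass_le HP) //.
  by rewrite mulr_ge0 // mulr_ge0 // invr_ge0 ltW.
by rewrite mulrAC ler_wpM2r.
Qed.

Lemma cell_mass_le0 M j : alpha = 0 -> (0 < M)%N ->
  cell_mass alpha M j <= gegenbauer_cst 0 * (2 / M%:R).
Proof.
move=> a0 M0; rewrite -lee_fin -(cell_massE HP) /gegenbauer_measure.
have MR : 0 < M%:R :> R by rewrite ltr0n.
have c0 : 0 <= gegenbauer_cst 0 :> R.
  by rewrite invr_ge0 Rintegral_ge0 // => y _; exact: powR_ge0.
apply: (@le_trans _ _ (\int[lebesgue_measure]_(x in cell M j) (gegenbauer_cst 0)%:E)%E).
  apply: ge0_le_integral => //; first exact: (measurable_cell M j).
  - by move=> x _; rewrite lee_fin gegenbauer_density_ge0.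
  - apply/measurable_EFinP; apply: measurable_funTS.
    exact: measurable_gegenbauer_density.
  move=> x _; rewrite lee_fin /gegenbauer_density a0 /gegenbauer_weight powRr0 mulr1.
  by rewrite ler_piMr // indicE lern1 leq_b1.
rewrite integral_cst; last exact: (measurable_cell M j).
have lebE : (lebesgue_measure (cell M j : set R) <= (2 / M%:R)%:E)%E.
  rewrite /cell lebesgue_measure_itv /=.
  case: ifP => _; last by rewrite lee_fin divr_ge0 // ltW.
  by rewrite -EFinB lee_fin -natr1; lra.
by rewrite EFinM lee_wpmul2l ?lee_fin.
Qed.

End quadrature.

(** Uniformity in M is the point. For alpha = -1/2 the weights are 1 and the total mass is a bound.
    For alpha = 0 the sum is dominated by a Riemann sum of (1 - x^2)^(-1/2), whose nodes stay at
    distance at least 1 / M from the end points. *)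
Lemma node_weight_sum (R : realType) (alpha : R) (P : nat -> {poly R}) :
  alpha = 0 \/ alpha = - 2^-1 -> is_orthonormal_polys alpha P ->
  exists2 Z : R, 0 < Z & forall M, (0 < M)%N ->
    \sum_(j < M.+1) cell_mass alpha M j / (1 - node M j ^+ 2) `^ (alpha + 2^-1) <= Z.
Proof.
case=> aE; last first.
  move=> HP; exists (\int[gegenbauer_measure alpha]_x (1 : {poly R}).[x]).
    exact: (gint1_gt0 HP).
  move=> M M0; rewrite (eq_bigr (fun j : 'I_M.+1 => cell_mass alpha M j)).
    exact: (sum_cell_mass_le HP).
  by move=> j _; rewrite aE addNr powRr0 divr1.
move=> HP; set c : R := gegenbauer_cst 0.
have c0 : 0 <= c by rewrite invr_ge0 Rintegral_ge0 // => y _; exact: powR_ge0.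
(* The estimate yields 12 c; adding 1 ensures positivity, since only c >= 0 is at hand. *)
exists (12 * c + 1); first by rewrite ltr_wpDl ?mulr_ge0.
move=> M M0; have MR : 0 < M%:R :> R by rewrite ltr0n.
set s : R := Num.sqrt M%:R.
have s0 : 0 < s by rewrite sqrtr_gt0.
have s2 : s ^+ 2 = M%:R by rewrite sqr_sqrtr // ltW.
pose u (j : nat) : R := (Num.sqrt (1 + node M j))^-1 + (Num.sqrt (1 - node M j))^-1.
have term j : cell_mass alpha M j / (1 - node M j ^+ 2) `^ (alpha + 2^-1)
    <= c * (2 / M%:R) * u j.
  have nI := @node_itv R M j M0; have /andP[n1 n2] := nI.
  rewrite aE add0r powR12_sqrt; last by nra.
  apply: ler_pM; rewrite ?cell_mass_ge0 ?invr_ge0 ?sqrtr_ge0 //.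
    by rewrite -aE (cell_mass_le0 HP).
  exact: invsqrt_1Bsqr_le.
have nb (i : nat) (y : R) : i.+1%:R / M%:R <= y ->
    (Num.sqrt y)^-1 <= s * (Num.sqrt i.+1%:R)^-1.
  move=> iy; rewrite -invf_div lef_pV2 ?posrE ?divr_gt0 ?sqrtr_gt0 ?ltr0n //.
    rewrite /s -sqrtrV ?ler0n // -sqrtrM ?ler0n //.
    by rewrite ler_wsqrtr.
  by rewrite (lt_le_trans _ iy) // divr_gt0 // ltr0n.
(* The extra cell of index M reuses the last node, at distance 1 / M from 1, and is estimated
   apart. *)
have uM : u M <= 2 * s.
  have nE : node M M = 1 - M%:R^-1 :> R.
    rewrite /node (minn_idPr _) ?leq_pred // -subn1 natrB //.
    by field; rewrite gt_eqF.
  have Mi : M%:R^-1 <= 1 :> R by rewrite invf_le1 // ler1n.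
  rewrite /u nE (_ : 2 * s = s * (Num.sqrt 1%:R)^-1 + s * (Num.sqrt 1%:R)^-1); last first.
    by rewrite sqrtr1 invr1; ring.
  by apply: lerD; apply: nb; lra.
have nodeE (j : 'I_M) : node M j = -1 + (2 * j%:R + 1) / M%:R :> R.
  by rewrite /node (minn_idPl _) // -ltnS prednK.
have u1 : \sum_(j < M) (Num.sqrt (1 + node M j))^-1 <= 2 * s ^+ 2.
  rewrite expr2 mulrCA; apply: (@le_trans _ _ (s * \sum_(j < M) (Num.sqrt (j.+1%:R : R))^-1)).
    rewrite mulr_sumr; apply: ler_sum => j _; apply: nb.
    rewrite nodeE addrA subrr add0r ler_wpM2r ?invr_ge0 ?(ltW MR) //.
    by have := ler0n R j; rewrite -(natr1 j); lra.
  by rewrite ler_wpM2l ?(ltW s0) ?sum_invsqrt_le.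
have u2 : \sum_(j < M) (Num.sqrt (1 - node M j))^-1 <= 2 * s ^+ 2.
  rewrite (reindex_inj rev_ord_inj) /=.
  rewrite expr2 mulrCA; apply: (@le_trans _ _ (s * \sum_(j < M) (Num.sqrt (j.+1%:R : R))^-1)).
    rewrite mulr_sumr; apply: ler_sum => j _; apply: nb.
    rewrite (nodeE (rev_ord j)) /= natrB //.
    rewrite (_ : 1 - _ = (2 * j%:R + 1) / M%:R); last first.
      by rewrite -(natr1 j); field; rewrite gt_eqF.
    rewrite ler_wpM2r ?invr_ge0 ?(ltW MR) //.
    by have := ler0n R j; rewrite -(natr1 j); lra.
  by rewrite ler_wpM2l ?(ltW s0) ?sum_invsqrt_le.
apply: (@le_trans _ _ (\sum_(j < M.+1) c * (2 / M%:R) * u j)); first exact: ler_sum.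
have uS : \sum_(j < M) u j <= 4 * s ^+ 2.
  by rewrite big_split /=; have := lerD u1 u2; lra.
rewrite -mulr_sumr big_ord_recr /=.
apply: (@le_trans _ _ (c * (2 / M%:R) * (6 * M%:R))).
  have cM0 : 0 <= c * (2 / M%:R) by rewrite mulr_ge0 // divr_ge0 // ltW.
  rewrite ler_wpM2l //.
  have s1 : 1 <= s by rewrite -[leLHS]sqrtr1 ler_wsqrtr // ler1n.
  have ss : s <= M%:R by rewrite -s2 expr2 ler_peMl // ltW.
  by rewrite s2 in uS; move: (lerD uS uM) ss; lra.
rewrite (_ : _ * (6 * _) = 12 * c); last by field; rewrite gt_eqF.
by lra.
Qed.

(** * Good nodes for the orthonormal system *)

Lemma sum_signed (R : realType) N (b : nat -> R) (F : 'I_N -> R) :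
  \sum_(i : 'I_N * bool) Num.max ((-1) ^+ i.2 * b i.1) 0 * ((-1) ^+ i.2 * F i.1) =
  \sum_(k < N) b k * F k.
Proof.
rewrite -(pair_bigA _ (fun (k : 'I_N) (e : bool) =>
  Num.max ((-1) ^+ e * b k) 0 * ((-1) ^+ e * F k))) /=.
apply: eq_bigr => k _; rewrite big_bool /= expr1 expr0 !mul1r !mulN1r.
by have [h|h] := leP 0 (b k); [rewrite max_r ?oppr_le0 //|rewrite max_l ?oppr_ge0 ?ltW //]; ring.
Qed.

Lemma sum_signed1 (R : realType) N (b : nat -> R) :
  \sum_(i : 'I_N * bool) Num.max ((-1) ^+ i.2 * b i.1) 0 = \sum_(k < N) `|b k|.
Proof.
rewrite -(pair_bigA _ (fun (k : 'I_N) (e : bool) => Num.max ((-1) ^+ e * b k) 0)) /=.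
apply: eq_bigr => k _; rewrite big_bool /= expr1 expr0 !mul1r !mulN1r.
have [h|h] := leP 0 (b k); first by rewrite max_r ?oppr_le0 // ger0_norm ?add0r.
by rewrite max_l ?oppr_ge0 ?(ltW h) // ltr0_norm ?addr0.
Qed.

Lemma ratio_bound (R : realFieldType) (s Z Z' K : R) :
  0 < s -> 0 <= Z -> Z' <= Z -> 0 <= K ->
  Z' * K / s + (s + 1)^-1 <= (128 * Z + Z * K + 1) / s.
Proof.
move=> s0 Z0 Z'Z K0.
rewrite ler_pdivlMr // mulrDl divfK ?gt_eqF //.
have a2 : (s + 1)^-1 * s <= 1 by rewrite mulrC ler_pdivrMr; lra.
by have := ler_wpM2r K0 Z'Z; lra.
Qed.

(** Importance sampling on the grid: a node is drawn with weight mass / (om Z'), and the dictionary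
    consists of sqrt(om) P_k / K, bounded by 1. The factors [om] cancel in the weighted mean of
    squares, which becomes the quadrature of h^2 up to normalisation. *)
Lemma sampling_points (R : realType) (alpha : R) (P : nat -> {poly R}) :
  alpha = 0 \/ alpha = - 2^-1 -> is_orthonormal_polys alpha P ->
  exists2 C1 : R, 0 < C1 & forall (N L ell m : nat) (s nu : R),
    (0 < N)%N -> 1 <= s -> 0 <= nu -> (2 * N)%:R <= expR nu ->
    8 * s <= 4 ^+ L -> (0 < ell)%N -> 512 * s <= expR ell%:R -> (0 < m)%N ->
    64 * s * L%:R * (512 * ell%:R * nu + L%:R) <= m%:R ->
    exists2 t : 'I_m -> R, (forall i, -1 < t i < 1) & forall b : nat -> R,
      \sum_(k < N) b k ^+ 2 <=
      C1 * (m%:R^-1 * \sum_i (1 - t i ^+ 2) `^ (alpha + 2^-1) *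
                            (\sum_(k < N) b k * (P k).[t i]) ^+ 2)
      + C1 / s * (\sum_(k < N) `|b k|) ^+ 2.
Proof.
move=> ha HP; have [Z Z0 hZ] := node_weight_sum ha HP.
have lam0 := gint1_gt0 HP; set lam := \int[_]_x _ in lam0.
pose K2 := 2 / lam; have K20 : 0 < K2 by rewrite divr_gt0.
pose K := Num.sqrt K2; have K0 : 0 < K by rewrite sqrtr_gt0.
have C10 : 0 < 128 * Z + Z * K2 + 1 by rewrite addr_gt0 // addr_gt0 // mulr_gt0.
exists (128 * Z + Z * K2 + 1) => //.
move=> N L ell m s nu N0 s1 nu0 hnu hL ell0 hell m0 hm.
have s0 : 0 < s by lra.
(* This error is at most 1 / s, the size allowed in the conclusion, and strictly below 1, as the
   proof that [Z'] is positive requires. *)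
have [|M M0 hM] := quadrature_lower HP N (eps := (s + 1)^-1).
  by rewrite invr_gt0; lra.
pose x (j : 'I_M.+1) : R := node M j.
pose om j := (1 - x j ^+ 2) `^ (alpha + 2^-1).
pose mass (j : 'I_M.+1) := cell_mass alpha M j.
have xI j : -1 < x j < 1 by exact: node_itv.
have om0 j : 0 < om j.
  by rewrite powR_gt0 //; have /andP[h1 h2] := xI j; nra.
have mass0 j : 0 <= mass j by exact: cell_mass_ge0.
pose Z' := \sum_j mass j / om j.
have Z'Z : Z' <= Z by exact: hZ.
have Z'0 : 0 < Z'.
  rewrite lt_neqAle sumr_ge0 ?andbT => [|j _]; last by rewrite divr_ge0 // ltW.
  apply/eqP => Z'0.
  have m00 j : mass j = 0.
    have : mass j / om j = 0.
      by apply: (psumr_eq0P _ (esym Z'0)) => // i _; rewrite divr_ge0 // ltW.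
    by move/eqP; rewrite mulf_eq0 invr_eq0 (gt_eqF (om0 j)) orbF => /eqP.
  (* If all cell masses vanished, the first unit vector would give 1 <= (s + 1)^-1. *)
  have := hM (fun k => (k == 0%N)%:R).
  have b0 (F : nat -> R) : F 0%N = 1 -> (forall k, F k.+1 = 0) -> \sum_(k < N) F k = 1.
    move=> F0 F1; case: (N) N0 => // n _; rewrite big_ord_recl F0 big1 ?addr0 // => i _.
    exact: F1.
  rewrite (b0 (fun k => (k == 0%N)%:R ^+ 2)) ?expr1n // => [|k]; last by rewrite expr0n.
  rewrite (b0 (fun k => `|(k == 0%N)%:R|)) ?normr1 // => [|k]; last by rewrite normr0.
  rewrite big1 => [|j _]; last by rewrite -/(mass j) m00 mul0r.
  rewrite add0r expr1n mulr1 leNgt invf_lt1; lra.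
pose w j := mass j / om j / Z'.
have w0 j : 0 <= w j by rewrite divr_ge0 // ?divr_ge0 // ltW.
have w1 : \sum_j w j = 1 by rewrite -mulr_suml divff // gt_eqF.
pose g (k : 'I_N) j := Num.sqrt (om j) * (P k).[x j] / K.
(* Each function enters with both signs: the positive and negative parts of b / |b|_1 are then the
   weights of a convex combination. *)
pose psi (i : 'I_N * bool) j := (-1) ^+ i.2 * g i.1 j.
have g1 k j : `|g k j| <= 1.
  rewrite -[leRHS](@normr1 R) -ler_sqr ?nnegrE // !real_normK ?num_real //.
  rewrite /g expr_div_n exprMn !sqr_sqrtr ?(ltW (om0 j)) ?(ltW K20) //.
  rewrite expr1n ler_pdivrMr // mul1r; apply: orthonormal_bound => //.
  by have /andP[h1 h2] := xI j; rewrite ler_norml !ltW.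
have psi1 i j : `|psi i j| <= 1 by rewrite /psi normrM normr_sign mul1r.
have hI : #|{: 'I_N * bool}|%:R <= expR nu.
  by rewrite card_prod card_ord card_bool mulnC.
have [t ht] := finite_sampling w0 w1 psi1 s0 nu0 hI hL ell0 hell m0 hm.
exists (fun i => x (t i)) => // b.
set B := \sum_(k < N) `|b k|.
have B0 : 0 <= B by exact: sumr_ge0.
have mi : 0 <= m%:R^-1 :> R by rewrite invr_ge0.
have [Bz|Bn] := eqVneq B 0.
  have bz (k : 'I_N) : b k = 0.
    by apply/eqP; rewrite -normr_eq0; apply/eqP/(psumr_eq0P _ Bz).
  rewrite Bz expr0n mulr0 addr0 big1 => [|k _]; last by rewrite bz expr0n.
  rewrite mulr_ge0 ?(ltW C10) // mulr_ge0 //.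
  by apply: sumr_ge0 => i _; rewrite mulr_ge0 ?powR_ge0 ?sqr_ge0.
have Bp : 0 < B by rewrite lt_neqAle eq_sym Bn.
pose q (i : 'I_N * bool) := Num.max ((-1) ^+ i.2 * b i.1) 0 / B.
have q0 i : 0 <= q i by rewrite divr_ge0 // le_max lexx orbT.
have q1 : \sum_i q i = 1 by rewrite -mulr_suml sum_signed1 divff.
pose h j := \sum_(k < N) b k * (P k).[x j].
have qE j : \sum_i q i * psi i j = Num.sqrt (om j) * h j / (K * B).
  rewrite (eq_bigr (fun i : 'I_N * bool => B^-1 * (Num.max ((-1) ^+ i.2 * b i.1) 0 *
     ((-1) ^+ i.2 * g i.1 j)))); last by move=> i _; rewrite /q /psi; ring.
  rewrite -mulr_sumr (sum_signed b (fun k => g k j)) /h mulr_sumr [X in _ = X / _]mulr_sumr mulr_suml.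
  by apply: eq_bigr => k _; rewrite /g; field; rewrite Bn gt_eqF.
have qE2 j : (\sum_i q i * psi i j) ^+ 2 = om j * h j ^+ 2 / (K2 * B ^+ 2).
  by rewrite qE expr_div_n !exprMn !sqr_sqrtr // ltW.
have := ht q q0 q1.
under eq_bigr do rewrite qE2.
under [in X in _ <= X -> _]eq_bigr do rewrite qE2.
move=> hh; apply: (le_trans (hM b)).
have e1 : \sum_(j < M.+1) cell_mass alpha M j * (\sum_(k < N) b k * (P k).[node M j]) ^+ 2
   = Z' * K2 * B ^+ 2 * \sum_j w j * (om j * h j ^+ 2 / (K2 * B ^+ 2)).
  rewrite mulr_sumr; apply: eq_bigr => j _.
  rewrite -/(mass j) -/(h j) /w; field.
  by rewrite Bn !gt_eqF.
rewrite e1.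
have KB : 0 < Z' * K2 * B ^+ 2 by apply: mulr_gt0; [exact: mulr_gt0|exact: exprn_gt0].
have h2 := ler_wpM2l (ltW KB) hh.
apply: (le_trans (lerD h2 (lexx _))).
set S := \sum_i om (t i) * h (t i) ^+ 2.
rewrite (_ : \sum_(i < m) om (t i) * h (t i) ^+ 2 / (K2 * B ^+ 2) = S / (K2 * B ^+ 2)); last first.
  by rewrite /S mulr_suml.
rewrite (_ : _ * (128 * _ + _) = 128 * Z' * (m%:R^-1 * S) + Z' * K2 / s * B ^+ 2); last first.
  by field; rewrite Bn !gt_eqF // ltr0n.
have S0 : 0 <= m%:R^-1 * S.
  by rewrite mulr_ge0 // sumr_ge0 // => i _; rewrite mulr_ge0 ?sqr_ge0 ?ltW.
have t1 : 128 * Z' * (m%:R^-1 * S) <= (128 * Z + Z * K2 + 1) * (m%:R^-1 * S).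
  rewrite ler_wpM2r //; have : 0 <= Z * K2 by rewrite mulr_ge0 // ltW.
  by lra.
have t2 := ratio_bound s0 (ltW Z0) Z'Z (ltW K20).
have := ler_wpM2r (sqr_ge0 B) t2; rewrite mulrDl.
rewrite -[X in _ <= _ * (_ * X) + _]/S.
by move: t1; rewrite -/B; set T := m%:R^-1 * S; lra.
Qed.

(** Cauchy-Schwarz on S, from the nonnegative sum of the (c x_k - T)^2, where c counts S and T is
    the sum of x over S. *)
Lemma sqr_sum_le_support (R : realFieldType) (N : nat) (x : nat -> R) (S : pred nat) :
  (\sum_(k < N | S k) x k) ^+ 2 <=
  (\sum_(k < N) (S k)%:R) * \sum_(k < N) x k ^+ 2.
Proof.
have cardE : \sum_(k < N) (S k)%:R = \sum_(k < N | S k) 1 :> R.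
  by rewrite [RHS]big_mkcond /=; apply: eq_bigr => k _; case: (S k).
rewrite cardE; apply: (@le_trans _ _
    ((\sum_(k < N | S k) 1) * \sum_(k < N | S k) x k ^+ 2)); last first.
  rewrite ler_wpM2l ?sumr_ge0 // [leLHS]big_mkcond /=; apply: ler_sum => k _.
  by case: (S k); rewrite ?sqr_ge0.
set c := \sum_(k < N | S k) 1; set T := \sum_(k < N | S k) x k.
have [c_eq0|c_neq0] := eqVneq c 0.
  rewrite /T big1 ?expr0n ?c_eq0 ?mul0r // => k Sk.
  have : 1 <= c by rewrite /c (bigD1 k) //= lerDl sumr_ge0.
  by rewrite c_eq0 ler10.
have c_gt0 : 0 < c by rewrite lt_neqAle eq_sym c_neq0 sumr_ge0.
rewrite -(ler_pM2l c_gt0) -subr_ge0.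
have : 0 <= \sum_(k < N | S k) (c * x k - T) ^+ 2.
  by apply: sumr_ge0 => k _; exact: sqr_ge0.
rewrite (eq_bigr (fun k : 'I_N => c ^+ 2 * x k ^+ 2 + (- 2 * c * T) * x k + T ^+ 2 * 1)).
  rewrite !big_split /= -!mulr_sumr -/T -/c; set Q := \sum_(k < N | S k) _ ^+ 2.
  by rewrite (_ : _ + _ = c * (c * Q) - c * T ^+ 2) //; ring.
by move=> k _; ring.
Qed.

(** * Sequences in a weighted l^p ball *)

Section weighted_lp.
Context {R : realType} (r p : R).
Hypotheses (r0 : 0 < r) (p0 : 0 < p) (p1 : p <= 1).
Variables (x : nat -> R) (A : R).
Hypothesis x0 : forall k, 0 <= x k.
Hypothesis A0 : 0 < A.

Let y k : R := x k * (1 + k%:R) `^ r.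

Hypothesis xA : forall K, \sum_(k < K) (x k * (1 + k%:R) `^ r) `^ p <= A.

Let y0 k : 0 <= y k. Proof. by rewrite mulr_ge0 ?powR_ge0. Qed.

Let yA k : y k `^ p <= A.
Proof.
apply: le_trans (xA k.+1); rewrite big_ord_recr /= lerDr.
by apply: sumr_ge0 => i _; exact: powR_ge0.
Qed.

(** From z = z^p z^(1 - p): a bound on the size of the terms turns an l^p bound into an l^1
    bound. *)
Let split_pow (z c : R) : 0 <= z <= c -> z <= z `^ p * c `^ (1 - p).
Proof.
move=> /andP[z0 zc]; have [->|zn] := eqVneq z 0.
  by rewrite mulr_ge0 ?powR_ge0.
rewrite -{1}(powRr1 z0) -{1}(subrKC p 1) powRD; last by rewrite zn implybT.
rewrite ler_wpM2l ?powR_ge0 // ge0_ler_powR ?nnegrE ?subr_ge0 //.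
exact: (le_trans z0).
Qed.

(** Every y_k is at most A^(1/p), so the y_k sum to at most A A^((1 - p) / p) = A^(1/p); the weight
    supplies N^-r. *)
Lemma weighted_lp_sum_tail N K : (0 < N)%N ->
  \sum_(N <= k < K) x k <= A `^ p^-1 * N%:R `^ (- r).
Proof.
move=> N0; have NR : 0 < N%:R :> R by rewrite ltr0n.
have pn : p != 0 by rewrite gt_eqF.
apply: (@le_trans _ _ (\sum_(N <= k < K) (y k `^ p * (A `^ p^-1) `^ (1 - p)) * N%:R `^ (- r))).
  rewrite big_nat_cond [leRHS]big_nat_cond; apply: ler_sum => k /andP[/andP[Nk _] _].
  apply: (@le_trans _ _ (y k * N%:R `^ (- r))).
    rewrite /y -mulrA ler_peMr // powRN ler_pdivlMr ?powR_gt0 // mul1r.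
    rewrite ge0_ler_powR ?nnegrE ?(ltW r0) // ?addr_ge0 //.
    by rewrite addrC natr1 ler_nat (leq_trans Nk).
  rewrite ler_wpM2r ?powR_ge0 // split_pow // y0 /=.
  rewrite -[leLHS](powRr1 (y0 k)) -(divff pn) powRrM ge0_ler_powR ?nnegrE ?powR_ge0 //.
    by rewrite invr_ge0 ltW.
  exact: ltW.
rewrite -mulr_suml ler_wpM2r ?powR_ge0 // -mulr_suml.
rewrite [leRHS](_ : _ = A * (A `^ p^-1) `^ (1 - p)); last first.
  rewrite -powRrM mulrBr mulr1 mulVf // -{2}(powRr1 (ltW A0)) -powRD ?(gt_eqF A0) ?implybT //.
  by congr (_ `^ _); ring.
rewrite ler_wpM2r ?powR_ge0 // (le_trans _ (xA K)) //.
rewrite -(big_mkord xpredT (fun k => y k `^ p)).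
have [NK|KN] := leqP N K; last first.
  by rewrite [leLHS]big_geq ?(ltnW KN) //; apply: sumr_ge0 => i _; exact: powR_ge0.
rewrite [leRHS](big_cat_nat (n := N)) //= lerDr.
by apply: sumr_ge0 => i _; exact: powR_ge0.
Qed.

Lemma weighted_lp_sqr_sum n N : (0 < n)%N ->
  (\sum_(k < N) x k) ^+ 2 <=
  2 * (1 + A) * n%:R * \sum_(k < N) x k ^+ 2
  + 2 * (A * n%:R `^ (1 - r - p^-1)) ^+ 2.
Proof.
move=> n0; have nR : 0 < n%:R :> R by rewrite ltr0n.
have pn : p != 0 by rewrite gt_eqF.
have powD a b : n%:R `^ a * n%:R `^ b = n%:R `^ (a + b) :> R.
  by rewrite powRD // (gt_eqF nR) implybT.
(* An index k >= n with x_k > D has y_k^p >= (D n^r)^p = 1 / n, so there are at most A n of them;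
   below this height x_k <= x_k^p D^(1 - p) produces the exponent 1 - r - 1/p. *)
pose D : R := n%:R `^ (- (r + p^-1)).
have D0 : 0 < D by rewrite powR_gt0.
pose S k := (k < n)%N || (D < x k).
have large k : (n <= k)%N -> n%:R `^ r <= (1 + k%:R) `^ r :> R.
  move=> nk; rewrite ge0_ler_powR ?nnegrE ?(ltW r0) ?addr_ge0 //.
  by rewrite addrC natr1 ler_nat (leq_trans nk).
have cardS : \sum_(k < N) (S k)%:R <= (1 + A) * n%:R.
  apply: (@le_trans _ _ (\sum_(k < N) ((k < n)%N%:R + n%:R * y k `^ p))).
    apply: ler_sum => k _; rewrite /S; have [kn|nk] := ltnP k n.
      by rewrite lerDl mulr_ge0 ?powR_ge0.
    rewrite add0r; have [Dx|] := ltP D (x k); last by rewrite mulr_ge0 ?powR_ge0.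
    rewrite -ler_pdivrMl // mulr1.
    apply: (@le_trans _ _ ((D * n%:R `^ r) `^ p)).
      rewrite /D powD (_ : _ + r = - p^-1); last by ring.
      by rewrite -powRrM mulNr mulVf // powR_inv1 // ltW.
    rewrite ge0_ler_powR ?nnegrE ?(ltW p0) ?mulr_ge0 ?powR_ge0 //.
    by rewrite ler_pM ?powR_ge0 // ?(ltW Dx) // large.
  rewrite big_split /= -mulr_sumr mulrDl mul1r lerD //.
    rewrite -natr_sum ler_nat; elim: (N) => [|M IH]; first by rewrite big_ord0.
    rewrite big_ord_recr /=; case: ltnP => [Mn|_]; last by rewrite addn0.
    rewrite addn1 (leq_ltn_trans _ Mn) // -[leqRHS]card_ord -sum1_card.
    by apply: leq_sum => i _; exact: leq_b1.
  by rewrite mulrC ler_wpM2r ?(ltW nR) //; exact: xA.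
have off : \sum_(k < N | ~~ S k) x k <= A * n%:R `^ (1 - r - p^-1).
  apply: (@le_trans _ _ (\sum_(k < N) y k `^ p * n%:R `^ (1 - r - p^-1))); last first.
    by rewrite -mulr_suml ler_wpM2r ?powR_ge0.
  rewrite big_mkcond /=; apply: ler_sum => k _.
  rewrite /S; case: ltnP => nk /=; first by rewrite mulr_ge0 ?powR_ge0.
  case: ltP => xD /=; first by rewrite mulr_ge0 ?powR_ge0.
  have /split_pow : 0 <= x k <= D by rewrite x0.
  move=> /le_trans; apply.
  have -> : n%:R `^ (1 - r - p^-1) = (n%:R `^ r) `^ (- p) * D `^ (1 - p).
    by rewrite /D -!powRrM powD; congr (_ `^ _); field.
  rewrite mulrA ler_wpM2r ?powR_ge0 // powRN ler_pdivlMr ?powR_gt0 //.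
  rewrite -(@powRM _ _ _ p (x0 k) (powR_ge0 n%:R r)).
  apply: ge0_ler_powR; rewrite ?nnegrE ?(ltW p0) ?y0 //.
    by rewrite mulr_ge0 ?powR_ge0 ?x0.
  by rewrite /y ler_wpM2l ?x0 // large.
rewrite (bigID (fun k : 'I_N => S k)) /=.
set a := \sum_(k < N | S k) _; set c := \sum_(k < N | ~~ _) _.
have c0 : 0 <= c by apply: sumr_ge0.
have ha : a ^+ 2 <= (1 + A) * n%:R * \sum_(k < N) x k ^+ 2.
  apply: (le_trans (sqr_sum_le_support _ _ _)); rewrite ler_wpM2r //.
  by apply: sumr_ge0 => k _; exact: sqr_ge0.
have hc : c ^+ 2 <= (A * n%:R `^ (1 - r - p^-1)) ^+ 2.
  by rewrite lerXn2r ?nnegrE ?mulr_ge0 ?powR_ge0 ?(ltW A0).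
have := sqr_ge0 (a - c); lra.
Qed.

End weighted_lp.

(** The quadratic bound gives exp(1/2) <= 2. Thus 4^ell >= exp(ell), and one integer can serve as
    both [L] and [ell]. *)
Lemma expR1_le4 (R : realType) : expR 1 <= 4 :> R.
Proof.
have := @expR_le_quad R 2^-1 (lexx _).
have := expR_gt0 (2^-1 : R).
rewrite (_ : expR 1 = expR 2^-1 ^+ 2 :> R); last by rewrite -expRM_natr; congr expR; lra.
by nra.
Qed.

Lemma ge_ceil_absz (R : realType) (x : R) : 0 <= x -> x <= `|Num.ceil x|%N%:R.
Proof.
move=> x0; have c0 : (0 <= Num.ceil x)%R by rewrite ceil_ge0 (lt_le_trans _ x0) // ltrN10.
by rewrite natr_absz ger0_norm // ceil_ge.
Qed.

(** * Choice of the parameters *)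

Section parameters.
Context {R : realType}.

(* Only the cube of the logarithm is needed; the fourth power absorbs the rest. *)
Lemma sampling_parameters (sigma kappa : R) : 1 <= sigma -> 0 <= kappa ->
  exists2 C : R, 0 < C & forall n m : nat, (0 < n)%N ->
    C * n%:R * ln (n.+1%:R) ^+ 4 <= m%:R ->
    exists (ell : nat) (nu : R),
    [/\ (0 < ell)%N, 0 <= nu & 4 * n.+1%:R `^ kappa <= expR nu] /\
    [/\ 8 * (sigma * n%:R) <= 4 ^+ ell, 512 * (sigma * n%:R) <= expR ell%:R,
        (0 < m)%N &
        64 * (sigma * n%:R) * ell%:R * (512 * ell%:R * nu + ell%:R) <= m%:R].
Proof.
move=> sigma1 kappa0; have sig0 : 0 < sigma by exact: lt_le_trans sigma1.
(* The numerals become variables of which only 8 <= k512 and 0 < k64 are retained. *)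
have [k512 k512E] : exists k : R, k = 512 by eexists.
have [k64 k64E] : exists k : R, k = 64 by eexists.
have k512_ge8 : 8 <= k512 by rewrite k512E ler_nat.
have k640 : 0 < k64 by rewrite k64E ltr0n.
rewrite -k512E -k64E {k512E k64E}.
have k5120 : 0 < k512 by lra.
have ks1 : 1 <= k512 * sigma by rewrite -[leLHS]mulr1 ler_pM //; lra.
(* ln 2 is a lower bound for ln(n + 1); dividing by it turns additive constants into multiples of
   ln(n + 1). *)
have [l2 l2E] : exists l2 : R, l2 = ln 2 by eexists.
have l20 : 0 < l2 by rewrite l2E ln_gt0 // ltr1n.
have [l4 l4E] : exists l4 : R, l4 = ln 4 by eexists.
have l40 : 0 <= l4 by rewrite l4E ln_ge0 // ler1n.
have [ls lsE] : exists ls : R, ls = ln (k512 * sigma) by eexists.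
have ls0 : 0 <= ls by rewrite lsE ln_ge0.
have [c1 c1E] : exists c1 : R, c1 = (ls + 1) / l2 + 1 by eexists.
have c10 : 0 < c1 by rewrite c1E ltr_wpDl // divr_ge0 ?(ltW l20) // addr_ge0.
have [c2 c2E] : exists c2 : R, c2 = l4 / l2 + kappa by eexists.
have c20 : 0 <= c2 by rewrite c2E addr_ge0 // divr_ge0 // ltW.
have C0 : 0 < k64 * sigma * c1 ^+ 2 * (k512 * c2 / l2 + l2^-1 ^+ 2).
  apply: mulr_gt0; first by rewrite !mulr_gt0 // exprn_gt0.
  by rewrite ltr_wpDl ?exprn_gt0 ?invr_gt0 // divr_ge0 ?(ltW l20) // mulr_ge0 // ltW.
exists (k64 * sigma * c1 ^+ 2 * (k512 * c2 / l2 + l2^-1 ^+ 2)) => // n m n0 hm.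
have nR : 1 <= n%:R :> R by rewrite ler1n.
have n1R : 0 < n.+1%:R :> R by rewrite ltr0n.
have m0 : (0 < m)%N.
  rewrite -(ltr0n R) (lt_le_trans _ hm) // mulr_gt0 //; last first.
    by rewrite exprn_gt0 // ln_gt0 // ltr1n.
  by rewrite mulr_gt0 //; lra.
have [lam lamE] : exists lam : R, lam = ln n.+1%:R by eexists.
rewrite -lamE in hm.
have lam2 : l2 <= lam by rewrite lamE l2E ler_ln ?posrE ?ltr0n // ler_nat.
have lam0 : 0 < lam by exact: lt_le_trans lam2.
have [T TE] : exists T : R, T = ls + ln (n%:R : R) by eexists.
have T0 : 0 <= T by rewrite TE addr_ge0 // ln_ge0.
have TE' : T = ln (k512 * (sigma * n%:R)).
  by rewrite TE lsE mulrA [RHS]lnM ?posrE ?ltr0n ?mulr_gt0.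
have Tlam : T <= ls + lam.
  by rewrite TE lerD2l lamE ler_ln ?posrE ?ltr0n // ler_nat.
have /andP[ellT1 ellT2] := truncn_itv T0.
have [ell ellE] : exists ell : nat, ell = (Num.truncn T).+1 by eexists.
rewrite -ellE in ellT2.
have ellR : ell%:R = (Num.truncn T)%:R + 1 :> R by rewrite ellE natr1.
have ell0 : (0 < ell)%N by rewrite ellE.
(* Chosen so that exp(nu) = 4 (n + 1)^kappa. *)
have [nu nuE] : exists nu : R, nu = l4 + kappa * lam by eexists.
have nu0 : 0 <= nu by rewrite nuE addr_ge0 // mulr_ge0 // ltW.
have sn0 : 0 < sigma * n%:R by rewrite mulr_gt0 //; lra.
have hell : k512 * (sigma * n%:R) <= expR ell%:R.
  rewrite -[leLHS]lnK; last by rewrite posrE mulr_gt0.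
  by rewrite ler_expR -TE' ltW.
have hell4 : 8 * (sigma * n%:R) <= 4 ^+ ell.
  have h4 : expR 1 ^+ ell <= 4 ^+ ell :> R.
    by rewrite lerXn2r ?nnegrE ?expR_ge0 ?expR1_le4.
  rewrite -expRM_natr mul1r in h4; apply: (le_trans _ (le_trans hell h4)).
  by rewrite ler_wpM2r // ltW.
have hnu : 4 * n.+1%:R `^ kappa <= expR nu.
  by rewrite nuE expRD l4E lnK ?posrE // /powR gt_eqF // lamE.
exists ell, nu; split; split => //.
have ellc1 : ell%:R <= c1 * lam.
  have h1 : ls + 1 <= (ls + 1) / l2 * lam.
    by rewrite -mulrA ler_peMr ?addr_ge0 // mulrC ler_pdivlMr // mul1r.
  by rewrite c1E mulrDl mul1r ellR; lra.
have nuc2 : nu <= c2 * lam.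
  rewrite nuE c2E mulrDl lerD2r -mulrA ler_peMr //.
  by rewrite mulrC ler_pdivlMr // mul1r.
apply: le_trans hm.
have e0 : 0 <= ell%:R :> R by [].
apply: (@le_trans _ _ (k64 * (sigma * n%:R) * (c1 * lam) *
    (k512 * (c1 * lam) * (c2 * lam) + c1 * lam))).
  apply: ler_pM.
  - by rewrite !mulr_ge0 // ltW.
  - by rewrite addr_ge0 // !mulr_ge0 // ltW.
  - by rewrite ler_wpM2l // mulr_ge0 // ltW.
  rewrite lerD // ler_pM ?mulr_ge0 ?(ltW k5120) //.
  by rewrite ler_wpM2l ?(ltW k5120).
rewrite (_ : _ * (_ + _) =
  k64 * sigma * c1 ^+ 2 * n%:R * (k512 * c2 * lam ^+ 3 + lam ^+ 2)); last by ring.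
rewrite (_ : k64 * sigma * c1 ^+ 2 * (k512 * c2 / l2 + l2^-1 ^+ 2) * n%:R * lam ^+ 4 =
  k64 * sigma * c1 ^+ 2 * n%:R * (k512 * c2 * (lam ^+ 4 / l2) + lam ^+ 4 / l2 ^+ 2)); last first.
  by field; rewrite gt_eqF.
rewrite ler_wpM2l //.
  by rewrite !mulr_ge0 // ?exprn_ge0 // ltW.
rewrite lerD //.
  rewrite ler_wpM2l ?mulr_ge0 ?(ltW k5120) // ler_pdivlMr // [leRHS]exprSr.
  by rewrite ler_wpM2l // exprn_ge0 // ltW.
rewrite ler_pdivlMr ?exprn_gt0 // (_ : lam ^+ 4 = lam ^+ 2 * lam ^+ 2); last by ring.
by rewrite ler_wpM2l ?sqr_ge0 // lerXn2r ?nnegrE ?(ltW lam0) ?(ltW l20).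
Qed.

End parameters.

(** Meant for the difference of two elements of the unit ball, whose l^p sum is at most 4 by a
    quasi-triangle inequality. The sequence is cut at N: the nodes control the head, the l^1 norm
    controls the tail. *)
Lemma samples_determine (R : realType) (alpha : R) (P : nat -> {poly R}) (r p : R) :
  alpha = 0 \/ alpha = - 2^-1 -> is_orthonormal_polys alpha P ->
  0 < r -> 0 < p <= 1 ->
  exists C Ct : R, [/\ 0 < C, 0 < Ct & forall n m : nat, (0 < n)%N ->
    C * n%:R * ln (n.+1%:R) ^+ 4 <= m%:R ->
    exists2 t : 'I_m -> R, (forall i, -1 < t i < 1) & forall b : nat -> R,
      (forall K, \sum_(k < K) (`|b k| * (1 + k%:R) `^ r) `^ p <= 4) ->
      (forall i, series (fun k => b k * (P k).[t i]) @ \oo --> (0 : R)) ->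
      forall K, \sum_(k < K) b k ^+ 2 <= Ct * (n%:R `^ (- (r + p^-1 - 2^-1))) ^+ 2].
Proof.
move=> ha HP r0 /andP[p0 p1].
have [C1 C10 hC1] := sampling_points ha HP.
have lam0 := gint1_gt0 HP.
have bnd := orthonormal_bound _ ha HP.
move: lam0 bnd; set lam := \int[_]_x _ => lam0 bnd.
have [K2 K2E] : exists K2 : R, K2 = 2 / lam by eexists.
have K20 : 0 < K2 by rewrite K2E divr_gt0.
have {}bnd n x : `|x| <= 1 -> (1 - x ^+ 2) `^ (alpha + 2^-1) * (P n).[x] ^+ 2 <= K2.
  by rewrite K2E; exact: bnd.
have [a aE] : exists a : R, a = 4 `^ p^-1 by eexists.
have a0 : 0 <= a by rewrite aE powR_ge0.
(* Then C1 / s <= 1 / (20 n), while |b|_1^2 <= 10 n |b|_2^2 + 32 n^2 W^2 for the head, so half of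
   |b|_2^2 can be absorbed. *)
have [sigma sigmaE] : exists sigma : R, sigma = 20 * (C1 + 1) by eexists.
have sigma1 : 1 <= sigma by lra.
have pV0 : 0 < p^-1 by rewrite invr_gt0.
(* N > n^kappa makes N^-r at most n^(-r - 1/p), the cutting height. *)
have [kappa kappaE] : exists kappa : R, kappa = (r + p^-1) / r by eexists.
have kappa0 : 0 <= kappa by rewrite kappaE divr_ge0 ?addr_ge0 ?ltW.
have [C C0 hC] := sampling_parameters sigma1 kappa0.
have CKa0 : 0 <= C1 * K2 * a ^+ 2 by rewrite !mulr_ge0 // ?sqr_ge0 // ltW.
(* Absorbing half of the head doubles C1 K2 a^2 + 2; the last a^2 is the share of the coefficients
   beyond N. *)
exists C, (2 * (C1 * K2 * a ^+ 2) + 4 + a ^+ 2); split => //.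
  by have := sqr_ge0 a; lra.
move=> n m n0 hm.
have [ell [nu [[ell0 nu0 hnu] [hL hell m0 hmm]]]] := hC n m n0 hm.
have nR : 1 <= n%:R :> R by rewrite ler1n.
have nR0 : 0 < n%:R :> R by rewrite ltr0n.
have [N NE] : exists N : nat, N = (Num.truncn (n%:R `^ kappa : R)).+1 by eexists.
have N0 : (0 < N)%N by rewrite NE.
have /andP[N1 N2] := truncn_itv (powR_ge0 n%:R kappa).
rewrite -NE in N2.
have nk1 : 1 <= n%:R `^ kappa :> R.
  by rewrite -[leLHS](powRr0 n%:R) ler_powR.
have nkn : n%:R `^ kappa <= n.+1%:R `^ kappa :> R.
  by rewrite ge0_ler_powR ?nnegrE // ler_nat.
have hN : (2 * N)%:R <= expR nu.
  by apply: le_trans hnu; rewrite natrM NE -natr1; clear -N1 nk1 nkn; lra.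
have [W WE] : exists W : R, W = n%:R `^ (- (r + p^-1)) by eexists.
have W0 : 0 < W by rewrite WE powR_gt0.
have NW : N%:R `^ (- r) <= W.
  rewrite WE !powRN lef_pV2 ?posrE ?powR_gt0 ?ltr0n //.
  have -> : n%:R `^ (r + p^-1) = (n%:R `^ kappa) `^ r :> R.
    by rewrite -powRrM kappaE divfK // gt_eqF.
  by rewrite ge0_ler_powR ?nnegrE ?powR_ge0 // ltW.
have [s sE] : exists s : R, s = sigma * n%:R by eexists.
have s1 : 1 <= s by rewrite sE -[leLHS]mulr1 ler_pM.
rewrite -sE in hL hell hmm.
have [t tI ht] := hC1 N ell ell m s nu N0 s1 nu0 hN hL ell0 hell m0 hmm.
exists t => // b hb hlim K.
have targetE : (n%:R `^ (- (r + p^-1 - 2^-1))) ^+ 2 = n%:R * W ^+ 2.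
  rewrite WE -!powR_mulrn ?powR_ge0 // -!powRrM.
  rewrite -[X in _ = X * _](powRr1 (ltW nR0)) -powRD ?(gt_eqF nR0) ?implybT //.
  by congr (_ `^ _); clear; lra.
have nDE : n%:R `^ (1 - r - p^-1) = n%:R * W.
  rewrite WE -[X in _ = X * _](powRr1 (ltW nR0)) -powRD ?(gt_eqF nR0) ?implybT //.
  by congr (_ `^ _); clear; lra.
have tail k0 : \sum_(N <= k < k0) `|b k| <= a * W.
  have := @weighted_lp_sum_tail R r p r0 p0 p1 (fun k => `|b k|) 4 (fun k => normr_ge0 _)
    (ltr0n R 4) hb N k0 N0.
  by move/le_trans; apply; rewrite -aE ler_wpM2l.
have l1 := @weighted_lp_sqr_sum R r p r0 p0 p1 (fun k => `|b k|) 4 (fun k => normr_ge0 _)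
    (ltr0n R 4) hb n N n0.
rewrite nDE in l1.
(* The full series vanishes at t_i, so the head is minus the tail there; the bound sqrt(K2 / om) on
   |P_k| cancels the weight. *)
have point i : (1 - t i ^+ 2) `^ (alpha + 2^-1) * (\sum_(k < N) b k * (P k).[t i]) ^+ 2
    <= K2 * (a * W) ^+ 2.
  have /andP[ti1 ti2] := tI i.
  have ti : `|t i| <= 1 by rewrite ler_norml !ltW.
  set om := (1 - t i ^+ 2) `^ _.
  have om0 : 0 < om by rewrite powR_gt0 //; clear -ti1 ti2; nra.
  set h := \sum_(k < N) _.
  have pk k : `|(P k).[t i]| <= Num.sqrt (K2 / om).
    rewrite -sqrtr_sqr ler_wsqrtr // ler_pdivlMr // mulrC.
    exact: bnd.
  pose tau := Num.sqrt (K2 / om) * (a * W).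
  have tau0 : 0 <= tau by rewrite !mulr_ge0 ?sqrtr_ge0 // ltW.
  have htau : `|h| <= tau.
    apply/ler_addgt0Pr => e e0.
    have /cvgr0Pnorm_lt/(_ e e0)[M _ hM] := hlim i.
    have := hM (maxn M N) (leq_maxl _ _).
    rewrite /series /= (big_cat_nat (n := N)) ?leq_maxr //= big_mkord -/h.
    set v := \sum_(N <= k < _) _ => hv.
    have hv2 : `|v| <= tau.
      rewrite /v /tau (le_trans (ler_norm_sum _ _ _)) //.
      apply: (@le_trans _ _ (Num.sqrt (K2 / om) * \sum_(N <= k < maxn M N) `|b k|)).
        rewrite mulr_sumr; apply: ler_sum => k _.
        by rewrite normrM mulrC ler_wpM2r.
      by rewrite ler_wpM2l ?sqrtr_ge0.
    have := ler_normB (h + v) v; rewrite addrK; clear -hv hv2; lra.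
  have : h ^+ 2 <= tau ^+ 2.
    by rewrite -real_normK ?num_real // lerXn2r ?nnegrE.
  rewrite /tau exprMn sqr_sqrtr ?divr_ge0 ?(ltW om0) ?(ltW K20) //.
  by rewrite [K2 / om * _]mulrAC ler_pdivlMr // mulrC.
have avg : m%:R^-1 * (\sum_(i < m) (1 - t i ^+ 2) `^ (alpha + 2^-1) *
    (\sum_(k < N) b k * (P k).[t i]) ^+ 2) <= K2 * (a * W) ^+ 2.
  rewrite mulrC ler_pdivrMr ?ltr0n //.
  apply: (le_trans (ler_sum _ (fun i _ => point i))).
  by rewrite sumr_const card_ord mulr_natr.
have head : \sum_(k < N) b k ^+ 2 <= (2 * (C1 * K2 * a ^+ 2) + 4) * (n%:R * W ^+ 2).
  have h1 := ht b; have h2 := ler_wpM2l (ltW C10) avg.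
  have sqE : \sum_(k < N) `|b k| ^+ 2 = \sum_(k < N) b k ^+ 2.
    by apply: eq_bigr => k _; rewrite real_normK ?num_real.
  rewrite sqE in l1; move: h1 h2 l1.
  set X := \sum_(k < N) b k ^+ 2; set Y := (\sum_(k < N) `|b k|) ^+ 2.
  set V := m%:R^-1 * _ => h1 h2 l1.
  have X0 : 0 <= X by apply: sumr_ge0 => k _; exact: sqr_ge0.
  have h3 : C1 / s * Y <= 2^-1 * X + 2 * (n%:R * W ^+ 2).
    have C1s : C1 / s <= 20^-1 / n%:R.
      have sn : 0 < sigma by apply: lt_le_trans sigma1.
      rewrite sE ler_pdivrMr ?mulr_gt0 // mulrCA mulfVK ?gt_eqF // sigmaE.
      by clear; lra.
    apply: (le_trans (ler_wpM2r _ C1s)); first exact: sqr_ge0.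
    apply: (le_trans (ler_wpM2l _ l1)); first by rewrite divr_ge0 // ltW.
    rewrite (_ : _ * (_ + _) = 2^-1 * X + 20^-1 * 32 * (n%:R * W ^+ 2)); last first.
      by field; rewrite gt_eqF.
    rewrite lerD2l ler_wpM2r ?mulr_ge0 ?sqr_ge0 ?(ltW nR0) ?(ltW W0) //; clear; lra.
  have h4 : C1 * (K2 * (a * W) ^+ 2) <= C1 * K2 * a ^+ 2 * (n%:R * W ^+ 2).
    rewrite (_ : C1 * _ = C1 * K2 * a ^+ 2 * W ^+ 2); last by ring.
    by rewrite ler_wpM2l // ler_peMl // sqr_ge0.
  by clear -h1 h2 h3 h4; lra.
rewrite targetE mulrDl.
have aW : (a * W) ^+ 2 <= a ^+ 2 * (n%:R * W ^+ 2).
  by rewrite exprMn ler_wpM2l ?sqr_ge0 // ler_peMl // sqr_ge0.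
have aW0 : 0 <= a * W by rewrite mulr_ge0 // ltW.
have [KN|NK] := leqP K N.
  have hKN : \sum_(k < K) b k ^+ 2 <= \sum_(k < N) b k ^+ 2.
    rewrite -!(big_mkord xpredT (fun k => b k ^+ 2)) [leRHS](big_cat_nat (n := K)) //=.
    by rewrite lerDl sumr_ge0 // => k _; exact: sqr_ge0.
  by have := sqr_ge0 (a * W); clear -hKN head aW; lra.
rewrite -(big_mkord xpredT (fun k => b k ^+ 2)) (big_cat_nat (n := N)) ?(ltnW NK) //=.
rewrite big_mkord lerD //.
apply: le_trans aW.
apply: (@le_trans _ _ (\sum_(N <= k < K) `|b k| * (a * W))).
  rewrite big_nat_cond [leRHS]big_nat_cond; apply: ler_sum => k /andP[/andP[Nk kK] _].
  rewrite -real_normK ?num_real // expr2 ler_wpM2l //.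
  apply: le_trans (tail k.+1); rewrite big_nat_recr //= lerDr.
  by apply: sumr_ge0.
by rewrite -mulr_suml expr2 ler_wpM2r.
Qed.

Lemma sampling_number_le (R : realType) (Omega : set R) (F X : set (R -> R[i]))
    (normF normX : (R -> R[i]) -> \bar R) (m : nat) (t : 'I_m -> R) (B : \bar R) :
  (forall i, Omega (t i)) -> X (fun=> 0) -> F `<=` X ->
  (forall f g, F f -> F g -> (normF f <= 1)%E -> (normF g <= 1)%E ->
     (forall i, f (t i) = g (t i)) -> (normX (fun x => (f x - g x)%R) <= B)%E) ->
  (sampling_number Omega F normF X normX m <= B)%E.
Proof.
move=> tO X0 FX h.
pose good (y : 'rV[R[i]]_m) g := [/\ F g, (normF g <= 1)%E & y = \row_i g (t i)].
(* On vectors that the ball does not attain the value is 0, hence the hypothesis that 0 lies in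
   [X]. *)
pose Rec (y : 'rV[R[i]]_m) : R -> R[i] := xget (fun=> 0) (good y).
apply: (@le_trans _ _ (ereal_sup [set normX (fun x => f x - Rec (\row_i f (t i)) x)
          | f in F `&` [set f | (normF f <= 1)%E]])).
  apply: ereal_inf_le; eexists; first by exists t.
  apply: ereal_inf_lbound; exists Rec => // y.
  by rewrite /Rec; case: xgetP => [g _ [/FX]|].
apply: ge_ereal_sup => _ [f [Ff f1] <-].
have : good (\row_i f (t i)) f by [].
move=> /(xgetI (fun=> 0)); rewrite -/(Rec _) => -[Fg g1 /rowP fg].
by apply: h => // i; have := fg i; rewrite !mxE.
Qed.

(** * From complex functions to real coefficient sequences *)

Section complex_limits.
Context {R : realType}.

Lemma cvg_ReIm (u : nat -> R[i]) (l : R[i]) :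
  ((u : nat -> R[i]^o) @ \oo --> (l : R[i]^o)) ->
  ((fun n => complex.Re (u n)) @ \oo --> complex.Re l) /\
  ((fun n => complex.Im (u n)) @ \oo --> complex.Im l).
Proof.
move=> /cvgrPdist_lt ul; split; apply/cvgrPdist_lt => e e0.
  have := ul e%:C%C; rewrite ltcR => /(_ e0); apply: filterS => n.
  rewrite -[ltRHS]/(e%:C)%C => h; rewrite -ltcR; apply: le_lt_trans h.
  by rewrite -raddfB; exact: normc_ge_Re.
have := ul e%:C%C; rewrite ltcR => /(_ e0); apply: filterS => n h.
rewrite -ltcR; apply: le_lt_trans h; rewrite -raddfB normc_def lecR.
by rewrite -sqrtr_sqr ler_wsqrtr // lerDr sqr_ge0.
Qed.

Lemma ReIm_mulr_real (c : R[i]) (x : R) :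
  complex.Re (c * (x%:C)%C) = complex.Re c * x /\
  complex.Im (c * (x%:C)%C) = complex.Im c * x.
Proof. by case: c => a b /=; split; ring. Qed.

Lemma ReIm_series (c : nat -> R[i]) (v : nat -> R) (n : nat) :
  complex.Re (series (fun k => c k * (v k)%:C%C : R[i]^o) n) =
    series (fun k => complex.Re (c k) * v k) n /\
  complex.Im (series (fun k => c k * (v k)%:C%C : R[i]^o) n) =
    series (fun k => complex.Im (c k) * v k) n.
Proof.
split; rewrite /series /= raddf_sum; apply: eq_bigr => k _.
  exact: (ReIm_mulr_real _ _).1.
exact: (ReIm_mulr_real _ _).2.
Qed.

Lemma normr_ReIm_le (z : R[i]) :
  `|complex.Re z| <= Normc.normc z /\ `|complex.Im z| <= Normc.normc z.
Proof.
by case: z => a b /=; split; rewrite -sqrtr_sqr ler_wsqrtr // ?lerDl ?lerDr sqr_ge0.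
Qed.

End complex_limits.

Section wiener_ball.
Context {R : realType} (alpha r p : R).
Hypotheses (p0 : 0 < p) (p1 : p <= 1).
Notation P := (gegenbauer_poly alpha).
Notation coef := (gegenbauer_coef alpha).
Notation W := (wiener_space alpha r p).

Lemma wiener_ball_coef f K : (wiener_norm alpha r p f <= 1)%E ->
  \sum_(k < K) (Normc.normc (coef f k) * (1 + k%:R) `^ r) `^ p <= 1.
Proof.
rewrite /wiener_norm; set S := (\sum_(0 <= n <oo) _)%E => S1.
have S0 : (0 <= S)%E.
  by apply: nneseries_ge0 => n _ _; rewrite lee_fin powR_ge0.
have {}S1 : (S <= 1)%E.
  move: S S0 S1 => [x| |] //=; last by rewrite invr_eq0 gt_eqF.
  rewrite !lee_fin => x0 xp; rewrite leNgt; apply/negP => x1.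
  move: xp; rewrite leNgt => /negP; apply.
  have : 1 `^ p^-1 < x `^ p^-1 by rewrite gt0_ltr_powR ?invr_gt0 ?nnegrE.
  by rewrite powR1.
rewrite -lee_fin; apply: le_trans S1.
rewrite -sumEFin -(big_mkord xpredT (fun k =>
  ((Normc.normc (coef f k) * (1 + k%:R) `^ r) `^ p)%:E)).
by apply: nneseries_lim_ge => n _ _; rewrite lee_fin powR_ge0.
Qed.

(** Via a + b <= 2 max(a, b) and 2^p <= 2. This factor 2, times two unit balls, is the origin of the
    bound 4. *)
Lemma powRD_le (a b : R) : 0 <= a -> 0 <= b -> (a + b) `^ p <= 2 * (a `^ p + b `^ p).
Proof.
move=> a0 b0; pose c := Num.max a b.
have c0 : 0 <= c by rewrite le_max a0.
apply: (@le_trans _ _ ((2 * c) `^ p)).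
  rewrite ge0_ler_powR ?nnegrE ?(ltW p0) ?addr_ge0 ?mulr_ge0 //.
  have : a <= c by rewrite le_max lexx.
  have : b <= c by rewrite le_max lexx orbT.
  by lra.
rewrite powRM //; apply: ler_pM; rewrite ?powR_ge0 //.
  by rewrite -[leRHS](powRr1 (ler0n R 2)) ler_powR // ler1n.
by rewrite /c; have [_|_] := leP a b; rewrite ?lerDl ?lerDr powR_ge0.
Qed.

Lemma sum_le4 K (u v x : nat -> R) : (forall k, x k <= 2 * (u k + v k)) ->
  \sum_(k < K) u k <= 1 -> \sum_(k < K) v k <= 1 -> \sum_(k < K) x k <= 4.
Proof.
move=> xuv u1 v1; apply: (@le_trans _ _ (\sum_(k < K) 2 * (u k + v k))).
  by apply: ler_sum => k _.
by rewrite -mulr_sumr big_split /=; lra.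
Qed.

Lemma wiener_ball_diff f g (b : nat -> R) :
  (wiener_norm alpha r p f <= 1)%E -> (wiener_norm alpha r p g <= 1)%E ->
  (forall k, `|b k| <= Normc.normc (coef f k) + Normc.normc (coef g k)) ->
  forall K, \sum_(k < K) (`|b k| * (1 + k%:R) `^ r) `^ p <= 4.
Proof.
move=> f1 g1 hb K.
have n0 (z : R[i]) : 0 <= Normc.normc z by case: z => x y; exact: sqrtr_ge0.
refine (@sum_le4 K (fun k => (Normc.normc (coef f k) * (1 + k%:R) `^ r) `^ p)
  (fun k => (Normc.normc (coef g k) * (1 + k%:R) `^ r) `^ p) (fun k => (`|b k| * (1 + k%:R) `^ r) `^ p) _
  (@wiener_ball_coef f K f1) (@wiener_ball_coef g K g1)) => k /=.
apply: le_trans (powRD_le _ _); rewrite ?mulr_ge0 ?powR_ge0 //.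
rewrite ge0_ler_powR ?nnegrE ?(ltW p0) ?addr_ge0 ?mulr_ge0 ?powR_ge0 //.
by rewrite -mulrDl ler_wpM2r ?powR_ge0.
Qed.

Lemma wiener_space_point f x : W f -> -1 < x < 1 ->
  (series (fun k => complex.Re (coef f k) * (P k).[x]) @ \oo --> complex.Re (f x)) /\
  (series (fun k => complex.Im (coef f k) * (P k).[x]) @ \oo --> complex.Im (f x)).
Proof.
move=> [_ _ hf] xI.
have /hf/cvg_ReIm[hRe hIm] : sample_domain alpha x.
  rewrite /sample_domain; case: ifP => _ /=; rewrite in_itv //=.
  by have /andP[h1 h2] := xI; rewrite !ltW.
split; [move: hRe|move: hIm]; apply: cvg_trans; apply: near_eq_cvg; apply: nearW => n /=;
  by have [h1 h2] := ReIm_series (coef f) (fun k => (P k).[x]) n; rewrite -?h1 -?h2.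
Qed.

End wiener_ball.

(** * From partial sums to the L^2 norm *)

Section fatou.
Context {R : realType} (alpha : R).
Notation mu := (gegenbauer_measure alpha).

(** The density vanishes outside [-1, 1] and the end points are null, so convergence on the open
    interval, which is what the Legendre case offers, is convergence almost everywhere. *)
Lemma gegenbauer_measure_null : mu (~` `](-1), 1[) = 0%E.
Proof.
rewrite /gegenbauer_measure; set D := ~` _.
pose N : set (measurableTypeR R) := [set -1] `|` [set 1].
have mN : measurable N by apply: measurableU; exact: measurable_set1.
have mD : measurable D by apply: measurableC; exact: measurable_itv.
have N0 : lebesgue_measure N = 0%E.
  by apply: countable_lebesgue_measure0; apply: finite_set_countable; rewrite finite_setU.
rewrite (ge0_negligible_integral mN mD _ _ N0).
- apply: integral0_eq => x [/= Dx Nx]; rewrite /gegenbauer_density indicE memNset ?mulr0 //=.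
  rewrite in_itv /= => /andP[x1 x2]; apply: Dx => /=; rewrite in_itv /= !lt_neqAle x1 x2 !andbT.
  by apply/andP; split; apply/eqP => xE; apply: Nx; [left|right].
- apply/measurable_EFinP; apply: measurable_funTS.
  exact: measurable_gegenbauer_density.
- by move=> x _; rewrite lee_fin gegenbauer_density_ge0.
Qed.

Lemma fatou_sqr_le (u : nat -> R -> R) (d : R -> R) (B : R) :
  (forall n, measurable_fun setT (u n : measurableTypeR R -> R)) ->
  measurable_fun setT (d : measurableTypeR R -> R) ->
  (forall x, -1 < x < 1 -> u ^~ x @ \oo --> d x) ->
  (forall n, (\int[mu]_x ((u n x) ^+ 2)%:E <= B%:E)%E) ->
  (\int[mu]_x ((d x) ^+ 2)%:E <= B%:E)%E.
Proof.
move=> mu_ md ud hB.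
pose I : set (measurableTypeR R) := `](-1), 1[%classic.
have mI : measurable I by exact: measurable_itv.
have mIC : measurable (~` I) by exact: measurableC.
have toI (f : R -> R) : measurable_fun setT (f : measurableTypeR R -> R) ->
    (\int[mu]_x ((f x) ^+ 2)%:E = \int[mu]_(x in I) ((f x) ^+ 2)%:E)%E.
  move=> mf; rewrite (@ge0_negligible_integral _ _ _ mu setT (~` I)) //.
  - by rewrite setTD setCK.
  - by apply/measurable_EFinP; exact: measurable_funX.
  - by move=> x _; rewrite lee_fin sqr_ge0.
  - exact: gegenbauer_measure_null.
rewrite (toI _ md).
have mu2 n : measurable_fun I (fun x : measurableTypeR R => ((u n x) ^+ 2)%:E).
  by apply: measurable_funTS; apply/measurable_EFinP; exact: measurable_funX.
have := @fatou _ _ _ mu I mI (fun n x => ((u n x) ^+ 2)%:E) mu2.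
have u0 n x : I x -> (0 <= ((u n x) ^+ 2)%:E)%E by move=> _; rewrite lee_fin sqr_ge0.
move=> /(_ u0) hF.
have -> : (\int[mu]_(x in I) ((d x) ^+ 2)%:E =
    \int[mu]_(x in I) limn_einf (fun n => ((u n x) ^+ 2)%:E))%E.
  apply: eq_integral => x; rewrite inE /I /= in_itv /= => xI.
  have dl : ((u n x) ^+ 2)%:E @[n --> \oo] --> ((d x) ^+ 2)%:E.
    by apply: cvg_EFin; [exact: nearW|rewrite /= !expr2; apply: cvgM; exact: ud].
  by have [-> _] := cvg_limn_einf_sup dl.
apply: (le_trans hF); rewrite limn_einf_lim; apply: lime_le; first exact: is_cvg_einfs.
apply: nearW => n; apply: (@le_trans _ _ (\int[mu]_(x in I) ((u n x) ^+ 2)%:E)%E).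
  by apply: ereal_inf_lbound; exists n => //=.
by rewrite -toI.
Qed.

End fatou.

Lemma L2norm_le (R : realType) (mu : {measure set (measurableTypeR R) -> \bar R})
    (h : R -> R[i]) (B : R) :
  measurable_fun setT (fun x : measurableTypeR R => complex.Re (h x)) ->
  measurable_fun setT (fun x : measurableTypeR R => complex.Im (h x)) ->
  (\int[mu]_x ((complex.Re (h x)) ^+ 2)%:E <= B%:E)%E ->
  (\int[mu]_x ((complex.Im (h x)) ^+ 2)%:E <= B%:E)%E ->
  (L2norm mu h <= (Num.sqrt (2 * B))%:E)%E.
Proof.
move=> mRe mIm hRe hIm.
have B0 : 0 <= B.
  by rewrite -lee_fin; apply: le_trans hRe; apply: integral_ge0 => x _; rewrite lee_fin sqr_ge0.
have m2 (f : R -> R) : measurable_fun setT (f : measurableTypeR R -> R) ->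
    measurable_fun setT (fun x : measurableTypeR R => ((f x) ^+ 2)%:E).
  by move=> mf; apply/measurable_EFinP; exact: measurable_funX.
rewrite /L2norm unlock.
have -> : (\int[mu]_x `| (Normc.normc (h x))%:E | `^ 2 =
    \int[mu]_x (((complex.Re (h x)) ^+ 2)%:E + ((complex.Im (h x)) ^+ 2)%:E))%E.
  apply: eq_integral => x _; case: (h x) => a b /=.
  rewrite ger0_norm ?sqrtr_ge0 // powR_mulrn ?sqrtr_ge0 // sqr_sqrtr //.
  by rewrite addr_ge0 ?sqr_ge0.
rewrite ge0_integralD //; first last.
- exact: m2.
- by move=> x _; rewrite lee_fin sqr_ge0.
- exact: m2.
- by move=> x _; rewrite lee_fin sqr_ge0.
set I := (_ + _)%E; have I2 : (I <= (2 * B)%:E)%E.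
  by rewrite mulr_natl mulr2n EFinD leeD.
have I0 : (0 <= I)%E.
  by apply: adde_ge0; apply: integral_ge0 => x _; rewrite lee_fin sqr_ge0.
move: I I0 I2 => [x| |] //= x0 x2; rewrite lee_fin in x0; rewrite lee_fin in x2.
by rewrite lee_fin powR12_sqrt // ler_wsqrtr.
Qed.

Section wiener_sampling.
Context {R : realType} (alpha r p : R).
Hypotheses (ha : alpha = 0 \/ alpha = - 2^-1) (r0 : 0 < r) (p01 : 0 < p <= 1).
Notation P := (gegenbauer_poly alpha).
Notation mu := (gegenbauer_measure alpha).

(* If no orthonormal sequence existed, gegenbauer_poly would be 0 and there
   would be nothing to prove; this spares a proof of existence. *)
Lemma samples_determine_L2 :
  exists C Ct : R, [/\ 0 < C, 0 < Ct & forall n m : nat, (0 < n)%N ->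
    C * n%:R * ln (n.+1%:R) ^+ 4 <= m%:R ->
    exists2 t : 'I_m -> R, (forall i, -1 < t i < 1) & forall b : nat -> R,
      (forall K, \sum_(k < K) (`|b k| * (1 + k%:R) `^ r) `^ p <= 4) ->
      (forall i, series (fun k => b k * (P k).[t i]) @ \oo --> (0 : R)) ->
      forall K, (\int[mu]_x ((series (fun k => b k * (P k).[x]) K) ^+ 2)%:E <=
        (Ct * (n%:R `^ (- (r + p^-1 - 2^-1))) ^+ 2)%:E)%E].
Proof.
have [exP|noP] := pselect (exists Q, is_orthonormal_polys alpha Q).
  have HP : is_orthonormal_polys alpha P.
    by case: exP => Q HQ; exact: (xgetPex (fun=> 0) (ex_intro _ Q HQ)).
  have [C [Ct [C0 Ct0 h]]] := samples_determine ha HP r0 p01.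
  exists C, Ct; split => // n m n0 hm; have [t tI ht] := h n m n0 hm.
  exists t => // b hb hl K; rewrite (le_trans _ (_ : ((\sum_(k < K) b k ^+ 2)%:E <= _)%E)) //.
    rewrite -(gint_sqr_comb HP) /Rintegral fineK; last first.
      exact: (integrable_fin_num measurableT (poly_integrable HP _)).
    rewrite le_eqVlt; apply/orP; left; apply/eqP; apply: eq_integral => x _.
    rewrite expr2 hornerM horner_sum -expr2 /series /= big_mkord.
    by congr ((_ ^+ 2)%:E); apply: eq_bigr => k _; rewrite hornerZ.
  by rewrite lee_fin; exact: ht.
have P0 : P = fun=> 0.
  by rewrite /gegenbauer_poly xgetPN // => Q HQ; apply: noP; exists Q.
exists 1, 1; split => // n m n0 _; exists (fun=> 0); first by rewrite ltrN10 ltr01.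
move=> b _ _ K; rewrite (_ : (fun x => _) = (fun=> 0%:E)).
  by rewrite integral0 lee_fin mulr_ge0 ?sqr_ge0.
apply/funext => x; rewrite /series /= big1 ?expr0n // => k _.
by rewrite P0 horner0 mulr0.
Qed.

Lemma wiener_sampling_number_le :
  exists C Ct : R, [/\ 0 < C, 0 < Ct & forall n m : nat, (0 < n)%N ->
    C * n%:R * ln (n.+1%:R) ^+ 4 <= m%:R ->
    (wiener_sampling_number alpha r p m <=
       (Ct * n%:R `^ (- (r + p^-1 - 2^-1)))%:E)%E].
Proof.
have [C [Ct [C0 Ct0 h]]] := samples_determine_L2.
have /andP[p0 p1] := p01.
exists C, (Num.sqrt (2 * Ct)); split => //; first by rewrite sqrtr_gt0 mulr_gt0.
move=> n m n0 hm; have [t tI ht] := h n m n0 hm.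
set E := n%:R `^ _; have E0 : 0 <= E by exact: powR_ge0.
apply: (@sampling_number_le _ _ _ _ _ _ _ t).
- move=> i; rewrite /sample_domain; case: ifP => _ /=; rewrite in_itv //=.
  by have /andP[h1 h2] := tI i; rewrite !ltW.
- split; [exact: measurable_cst|exact: measurable_cst|].
  apply: (@le_lt_trans _ _ (Num.sqrt (2 * 0))%:E); last exact: ltry.
  apply: L2norm_le => /=; [exact: measurable_cst|exact: measurable_cst| |];
    by under eq_integral do rewrite /= expr0n; rewrite integral0.
- by move=> f [].
move=> f g Wf Wg f1 g1 fg.
have -> : Num.sqrt (2 * Ct) * E = Num.sqrt (2 * (Ct * E ^+ 2)).
  by rewrite mulrA [in RHS]sqrtrM ?mulr_ge0 ?(ltW Ct0) // sqrtr_sqr ger0_norm.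
(* Run once for the real and once for the imaginary parts: as [f] and [g] agree at the nodes, the
   difference series tends to 0 there. *)
have part (cf cg : nat -> R) (F G : R -> R) :
    measurable_fun setT (F : measurableTypeR R -> R) ->
    measurable_fun setT (G : measurableTypeR R -> R) ->
    (forall x, -1 < x < 1 -> series (fun k => cf k * (P k).[x]) @ \oo --> F x) ->
    (forall x, -1 < x < 1 -> series (fun k => cg k * (P k).[x]) @ \oo --> G x) ->
    (forall i, F (t i) = G (t i)) ->
    (forall k, `|cf k| <= Normc.normc (gegenbauer_coef alpha f k)) ->
    (forall k, `|cg k| <= Normc.normc (gegenbauer_coef alpha g k)) ->
    (\int[mu]_x ((F x - G x) ^+ 2)%:E <= (Ct * E ^+ 2)%:E)%E.
  move=> mF mG limF limG FG cfb cgb; pose b k := cf k - cg k.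
  have bE x : series (fun k => b k * (P k).[x]) =
      (fun K => series (fun k => cf k * (P k).[x]) K - series (fun k => cg k * (P k).[x]) K).
    apply/funext => K; rewrite /series /= -sumrB; apply: eq_bigr => k _.
    by rewrite mulrBl.
  have lim x : -1 < x < 1 -> series (fun k => b k * (P k).[x]) @ \oo --> F x - G x.
    by move=> xI; rewrite bE; apply: cvgB; [exact: limF|exact: limG].
  apply: (@fatou_sqr_le _ _ (fun K x => series (fun k => b k * (P k).[x]) K)) => //.
  - move=> K; rewrite /series /=; apply: measurable_sum => k.
    by apply: measurable_funM => //; exact: measurable_horner.
  - exact: measurable_funB.
  - apply: ht.
      apply: (wiener_ball_diff p0 p1 f1 g1) => k.
      by rewrite (le_trans (ler_normB _ _)) // lerD.
    by move=> i; rewrite -[X in _ --> X](subrr (F (t i))) {2}FG; exact: lim.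
have [[mf1 mf2 _] _ _] := Wf; have [[mg1 mg2 _] _ _] := Wg.
have ReB (z z' : R[i]) : complex.Re (z - z') = complex.Re z - complex.Re z'.
  by rewrite raddfB.
have ImB (z z' : R[i]) : complex.Im (z - z') = complex.Im z - complex.Im z'.
  by rewrite raddfB.
apply: L2norm_le.
- by under eq_fun do rewrite ReB; exact: measurable_funB.
- by under eq_fun do rewrite ImB; exact: measurable_funB.
- under eq_integral do rewrite ReB.
  apply: (@part (fun k => complex.Re (gegenbauer_coef alpha f k))
    (fun k => complex.Re (gegenbauer_coef alpha g k))) => //.
  + by move=> x /(wiener_space_point Wf)[].
  + by move=> x /(wiener_space_point Wg)[].
  + by move=> i; rewrite fg.
  + by move=> k; have [] := normr_ReIm_le (gegenbauer_coef alpha f k).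
  + by move=> k; have [] := normr_ReIm_le (gegenbauer_coef alpha g k).
- under eq_integral do rewrite ImB.
  apply: (@part (fun k => complex.Im (gegenbauer_coef alpha f k))
    (fun k => complex.Im (gegenbauer_coef alpha g k))) => //.
  + by move=> x /(wiener_space_point Wf)[].
  + by move=> x /(wiener_space_point Wg)[].
  + by move=> i; rewrite fg.
  + by move=> k; have [] := normr_ReIm_le (gegenbauer_coef alpha f k).
  + by move=> k; have [] := normr_ReIm_le (gegenbauer_coef alpha g k).
Qed.

End wiener_sampling.

Lemma wiener_sampling_number_rate (R : realType) (alpha r p : R) :
  alpha = 0 \/ alpha = - 2^-1 -> 0 < r -> 0 < p <= 1 ->
  exists C Ct : R, [/\ 0 < C, 0 < Ct & forall n : nat, (0 < n)%N ->
    (wiener_sampling_number alpha r p `|Num.ceil (C * n%:R * ln (n.+1%:R) ^+ 4)|%N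
     <= (Ct * n%:R `^ (- (r + p^-1 - 2^-1)))%:E)%E].
Proof.
move=> ha r0 p01; have [C [Ct [C0 Ct0 h]]] := wiener_sampling_number_le ha r0 p01.
exists C, Ct; split => // n n0; apply: h => //; apply: ge_ceil_absz.
by rewrite mulr_ge0 ?exprn_ge0 ?ln_ge0 ?ler1n // mulr_ge0 // ltW.
Qed.

Theorem corollary4p9 (R : realType) :
  [/\ (forall r p : R, 0 < r -> 0 < p <= 1 ->
        exists C Ct : R, [/\ 0 < C, 0 < Ct &
          forall n : nat, (0 < n)%N ->
            (wiener_sampling_number 0 r p
               `|Num.ceil (C * n%:R * ln (n.+1%:R) ^+ 4)|%N
             <= (Ct * n%:R `^ (- (r + p^-1 - 1)))%:E)%E]),
      (forall r p : R, 0 < r -> 0 < p <= 1 ->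
        exists C Ct : R, [/\ 0 < C, 0 < Ct &
          forall n : nat, (0 < n)%N ->
            (wiener_sampling_number (- 2^-1) r p
               `|Num.ceil (C * n%:R * ln (n.+1%:R) ^+ 4)|%N
             <= (Ct * n%:R `^ (- (r + p^-1 - 2^-1)))%:E)%E]) &
      (forall r : R, 0 < r ->
        exists C Ct : R, [/\ 0 < C, 0 < Ct &
          forall n : nat, (0 < n)%N ->
            (wiener_sampling_number (- 2^-1) r 1
               `|Num.ceil (C * n%:R * ln (n.+1%:R) ^+ 4)|%N
             <= (Ct * n%:R `^ (- (r + 2^-1)))%:E)%E])].
Proof.
split=> [r p r0 p01|r p r0 p01|r r0].
- have [C [Ct [C0 Ct0 h]]] := wiener_sampling_number_rate (or_introl erefl) r0 p01.
  exists C, Ct; split => // n n0; apply: (le_trans (h n n0)).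
  (* The rate obtained is better than the claimed one by n^(-1/2), and n >= 1. *)
  rewrite lee_fin ler_wpM2l ?(ltW Ct0) // ler_powR ?ler1n //; lra.
- by apply: wiener_sampling_number_rate => //; right.
have p01 : 0 < (1 : R) <= 1 by rewrite ltr01 lexx.
have [C [Ct [C0 Ct0 h]]] := wiener_sampling_number_rate (or_intror erefl) r0 p01.
exists C, Ct; split => // n n0.
rewrite (_ : - (r + 2^-1) = - (r + 1^-1 - 2^-1)); last by rewrite invr1; lra.
exact: h.
Qed.
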